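(* Let $m\ge3$, $d\ge2$, and $k\ge1$ be integers, and $R=\mathbb Z/m\mathbb Z$. Suppose a connection multiset $S$ on $R^d$ has a partition $$S=B_1\mathbin{\dot\cup}\cdots\mathbin{\dot\cup}B_k$$ in which each $B_j$ is an $R$-module basis of $R^d$. Then $\mathrm{Cay}(R^d,S)$ has a decomposition into $kd$ directed Hamilton cycles. In particular, for every $R$-module basis $B$ of $R^d$, $\mathrm{Cay}(R^d,B)$ has a decomposition into $d$ directed Hamilton cycles.
   Context: $\mathrm{Cay}(R^d,S)$ has vertex set $R^d$ and, for each vertex $x$ and each occurrence of an element $s$ in the multiset $S$, a separately labelled arc $x\to x+s$. The partition is a partition of the occurrences in $S$. A decomposition into directed Hamilton cycles is a partition of the (labelled) arc set into directed spanning cycles. *)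

(* Defs.v *)
From mathcomp Require Import all_boot all_order all_algebra.
From mathcomp Require Import finmap multiset.

Set Implicit Arguments.
Unset Strict Implicit.
Unset Printing Implicit Defensive.

Import GRing.Theory.
Local Open Scope ring_scope.
Local Open Scope mset_scope.

(* Finite directed multigraphs: loops and parallel arcs are allowed. *)
Record digraph := Digraph {
  vertex : finType;
  arc : finType;
  source : arc -> vertex;
  target : arc -> vertex
}.

(* [C] is the arc set of a directed cycle that visits every vertex of [G]
   exactly once; [p] lists its arcs in cyclic order. *)
Definition hamilton_cycle (G : digraph) (C : {set arc G}) : Prop :=
  exists p : seq (arc G),
    [/\ cycle (fun a b => target a == source b) p,
        uniq (map (@source G) p),
        forall v : vertex G, v \in map (@source G) p
      & C = [set a in p]].

Definition hamilton_decomposable (G : digraph) (n : nat) : Prop :=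
  exists D : {set {set arc G}},
    [/\ partition D [set: arc G], #|D| = n
      & forall C, C \in D -> hamilton_cycle C].

(* The occurrences of elements in a multiset: [Tagged _ i], with tag [x] and
   [i < S x], is the [i]-th occurrence of [x]. *)
Definition occ (V : finType) (S : {mset V}) : finType := {x : V & 'I_(S x)}.

Definition Cay (V : finZmodType) (S : {mset V}) : digraph :=
  @Digraph V (V * occ S)%type
    (fun a => a.1) (fun a => a.1 + tag a.2).

(* The family [b i], for [i \in A], is a basis of the [R]-module [V]. (The
   library's [basis_of] requires the scalars to form a field.) *)
Definition module_basis (R : nzRingType) (V : lmodType R) (I : finType)
    (A : {set I}) (b : I -> V) : Prop :=
  (forall c : I -> R,
     \sum_(i in A) c i *: b i = 0 -> forall i, i \in A -> c i = 0) /\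
  (forall v : V, exists c : I -> R, v = \sum_(i in A) c i *: b i).

Definition mset_of_set (V : finType) (B : {set V}) : {mset V} :=
  seq_mset (enum B).

(* Main.v *)
Require Import Defs.
From mathcomp Require Import all_boot all_order all_algebra.
From mathcomp Require Import finmap multiset.
From mathcomp Require Import zify ring.

Import GRing.Theory.
Local Open Scope ring_scope.
Local Open Scope mset_scope.

Set Implicit Arguments.
Unset Strict Implicit.
Unset Printing Implicit Defensive.

(** Coordinates with respect to a basis turn the module into the torus
    [Z_m ^ d], and the arcs labelled by the basis into the unit steps of the
    torus. A decomposition into [d] directed Hamilton cycles is a recolouring of
    this torus: at each point the [d] directions are permuted, and each colour
    becomes a map of the points to themselves, which must consist of a single
    cycle ([full]). So it is enough to recolour the torus ([decomposes_ord]).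
    A module basis has exactly [d] elements because the module has [m ^ d]
    points; and the bases of a partition of the multiset are treated one by one,
    their cycles being put together at the end ([cayley_decomposable]).

    The recolouring is built by induction on [d]. A torus of dimension [2 d] is a
    product of two recoloured tori of dimension [d], where it suffices to let the
    two copies of each colour change places on one diagonal
    ([decomposes_double]). In odd dimension there is an extra direction, and the
    new torus is cut into [m] layers by the sum of its coordinates: each step
    goes to the next layer, the extra direction does nothing else, and the
    recolouring may be prescribed layer by layer. For odd [m] this leads from [d]
    to [2 d + 1] ([decomposes_odd_step]), for even [m] from [d] to [2 d + 3]
    ([decomposes_even_step]); dimensions one and three are done directly.

    All single cycles are recognised by one principle, [skew_full]: a map that
    covers a single cycle of a base is a single cycle if the map of a fibre to
    itself that is picked up along one turn is. Usually the fibre maps met on the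
    way are controlled by an additive invariant, and it remains to see that two
    totals are prime to [m] (the class [tri]). Two irregular cases are settled by
    following orbits: [sweep_full], where the rows of a torus are swept by
    unrelated cycles, and [stair_full].

    The parity of [m] matters since a single cycle on an even number of points is
    an odd permutation. For even [m], the exchanges of directions along the rows
    of a torus cannot be distributed so as to suit all colours (see
    [odd_labels]). The cure is a recolouring of the plane
    [Z_m ^ 2] with three colours, one of them standing for no move at all, which
    is odd in each colour; this is what [odd_plane] asks for. It gives dimension
    three at once, and it is carried along as a plane factor in the step from [d]
    to [2 d + 3]. *)

(** * Maps with a single cycle *)

Definition full (T : Type) (f : T -> T) :=
  forall x y, exists k, iter k f x = y.

Lemma full_eq (T : Type) (f g : T -> T) : f =1 g -> full f -> full g.
Proof. by move=> fg Hf x y; have [k <-] := Hf x y; exists k; rewrite (eq_iter fg). Qed.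

Lemma full_inj (T : finType) (f : T -> T) : full f -> injective f.
Proof.
move=> Hf; have Hs : forall y, y \in codom f.
  move=> y; have [k Hk] := Hf (f y) y; apply/codomP; exists (iter k f y).
  by rewrite -iterS iterSr.
apply/injectiveP; rewrite /injectiveb /dinjectiveb.
apply: (@leq_size_uniq T (enum T)); rewrite ?enum_uniq ?size_map //.
Qed.

Lemma full_map (T T' : Type) (h : T -> T') (f : T -> T) (g : T' -> T') :
  (forall y, exists x, h x = y) -> (forall x, h (f x) = g (h x)) ->
  full f -> full g.
Proof.
move=> hs hfg Hf x' y'; have [x <-] := hs x'; have [y <-] := hs y'.
have [k <-] := Hf x y; exists k.
by elim: k => //= k ->.
Qed.

Lemma full_bij (T : finType) (f : T -> T) : full f -> bijective f.
Proof. by move/full_inj/injF_bij. Qed.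

Lemma full_order (T : finType) (f : T -> T) x : full f -> order f x = #|T|.
Proof.
move=> Hf; rewrite /order; apply: eq_card => y; rewrite inE.
have [k <-] := Hf x y; by rewrite fconnect_iter.
Qed.

Lemma full_iter_card (T : finType) (f : T -> T) x : full f -> iter #|T| f x = x.
Proof. by move=> Hf; rewrite -(full_order x Hf) iter_order //; apply: full_inj. Qed.

Lemma perm_traject_full (T : finType) (f : T -> T) x :
  full f -> perm_eq (traject f x #|T|) (enum T).
Proof.
move=> Hf; rewrite -(full_order x Hf) -/(orbit f x).
apply: uniq_perm; rewrite ?enum_uniq ?orbit_uniq // => y.
rewrite mem_enum -fconnect_orbit; have [k <-] := Hf x y.
by rewrite fconnect_iter.
Qed.

Lemma full_iter_mod (T : finType) (f : T -> T) x k :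
  full f -> iter k f x = iter (k %% #|T|) f x.
Proof.
move=> Hf; rewrite {1}(divn_eq k #|T|) addnC iterD; congr (iter _ _ _).
by elim: (k %/ _)%N => //= q IH; rewrite mulSn iterD IH full_iter_card.
Qed.

Lemma full_iter (T : finType) (f : T -> T) k :
  full f -> coprime k #|T| -> full (iter k f).
Proof.
move=> Hf co x y; have [j <-] := Hf x y.
case: (posnP k) co => [-> | k0 co].
  rewrite /coprime gcd0n => /eqP T1; exists 0%N.
  by rewrite [RHS]full_iter_mod // T1 modn1.
have [[u w] /= Hu] := coprimeP _ k0 co.
have {}Hu : (u * k = w * #|T| + 1)%N.
  by have := Hu; move: (u * k)%N (w * #|T|)%N; clear=> p q; lia.
exists (u * j)%N; rewrite -iterM (_ : (u * j * k = w * j * #|T| + j)%N); last first.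
  by rewrite mulnAC Hu mulnDl mul1n mulnAC.
by rewrite full_iter_mod // modnMDl -full_iter_mod.
Qed.

(** * Skew products *)

(** The first return to the fibre over [k0] is the composite of the fibre maps
    met along one turn of [r], and a cycle of the return map is spread over the
    whole space by the turns. The order of the turn is not known, so the fibre
    maps away from [k0] are only required to lie in a class [C] of maps whose
    composites are controlled by an additive invariant; they need not
    commute. *)
Lemma skew_full (T K X : finType) (rho : T -> K) (chi : T -> X) (f : T -> T)
    (r : K -> K) (h : K -> X -> X) (k0 : K)
    (M : nmodType) (C : (X -> X) -> M -> Prop) (a : K -> M) :
  bijective (fun t => (rho t, chi t)) ->
  (forall t, rho (f t) = r (rho t) /\ chi (f t) = h (rho t) (chi t)) ->
  full r ->
  (forall g g' n, g =1 g' -> C g n -> C g' n) ->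
  C id 0 ->
  (forall g g' n n', C g n -> C g' n' -> C (g' \o g) (n + n')) ->
  a k0 = 0 ->
  (forall k, k != k0 -> C (h k) (a k)) ->
  (forall F, C F (\sum_k a k) -> full (F \o h k0)) ->
  full f.
Proof.
move=> [inv invK Kinv] Hf Hr Cext C1 Cm a0 Ca Hfull.
pose S (p : K * X) := (r p.1, h p.1 p.2).
suff HS : full S.
  apply: (full_map (h := inv) _ _ HS) => [y|[k x]].
    by exists (rho y, chi y).
  have := Kinv (k, x) => [[e1 e2]]; have [e3 e4] := Hf (inv (k, x)).
  by rewrite -[RHS]invK e3 e4 e1 e2.
have S1 n p : (iter n S p).1 = iter n r p.1 by elim: n => //= n ->.
pose N := #|K|.-1.
have K1 : #|K| = N.+1 by rewrite prednK //; apply/card_gt0P; exists k0.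
have orb : forall n, (n < N)%N -> iter n r (r k0) != k0.
  move=> n nN; apply/negP => /eqP e.
  have := orbit_uniq r k0; rewrite /orbit full_order // K1 /= => /andP [+ _].
  rewrite -[X in X \notin _]e => /negP; apply.
  by rewrite -(nth_traject r nN (r k0)) mem_nth // size_traject.
pose F n x := (iter n S (r k0, x)).2.
have CF : forall n, (n <= N)%N -> C (F n) (\sum_(0 <= i < n) a (iter i r (r k0))).
  elim=> [|n IH] nN; first by rewrite big_nil; apply: Cext C1.
  rewrite big_nat_recr //=; apply: Cext (Cm _ _ _ _ (IH (ltnW nN)) (Ca _ (orb n nN))) => x.
  by rewrite /F /= S1.
have sumE : \sum_(0 <= i < N) a (iter i r (r k0)) = \sum_k a k.
  rewrite -[RHS](big_enum) -(perm_big _ (perm_traject_full k0 Hr)) K1 /= big_cons a0 add0r.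
  rewrite [RHS](big_nth (r k0)) size_traject [LHS]big_nat [RHS]big_nat.
  apply: eq_bigr => i /andP [_ iN]. by rewrite (nth_traject r iN).
have HG : full (F N \o h k0) by apply: Hfull; rewrite -sumE; apply: CF.
set G := (_ \o _) in HG.
have GE x : G x = (iter N.+1 S (k0, x)).2 by rewrite iterSr.
have Gk0 x : iter N.+1 S (k0, x) = (k0, G x).
  by rewrite GE [LHS]surjective_pairing S1 -K1 full_iter_card.
have Gj j x : iter (j * N.+1) S (k0, x) = (k0, iter j G x).
  by elim: j => [|j IH] //; rewrite mulSn iterD IH Gk0.
move=> [k x] [k' x'].
have [n Hn] := Hr k k0; have [n' Hn'] := Hr k0 k'.
have n'N : (n' %% N.+1 < N.+1)%N by rewrite ltn_mod.
rewrite full_iter_mod // K1 in Hn'; move: (n' %% _)%N n'N Hn' => {}n' n'N Hn'.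
pose g y := (iter n' S (k0, y)).2.
have gi : injective g.
  move=> y z e; apply: (full_inj HG); rewrite !GE.
  rewrite -(subnK (ltnW n'N)) [(N.+1 - n' + n')%N]/= !iterD.
  by congr (iter _ S _).2; rewrite [LHS]surjective_pairing [RHS]surjective_pairing !S1 -/(g y) e.
have [g' _ gK] := injF_bij gi.
have [j Hj] := HG (iter n S (k, x)).2 (g' x').
exists (n' + (j * N.+1 + n))%N; rewrite !iterD.
rewrite [iter n S (k, x)]surjective_pairing S1 Hn Gj Hj.
by rewrite [LHS]surjective_pairing S1 Hn' -/(g (g' x')) gK.
Qed.

Lemma iter_succ (p k : nat) (x : 'Z_p) : iter k (fun s => s + 1) x = x + k%:R.
Proof. by elim: k => [|k IH]; rewrite ?addr0 //= IH -addrA -mulrSr. Qed.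

Lemma full_succ (p : nat) : full (fun s : 'Z_p => s + 1).
Proof.
by move=> x y; exists (val (y - x)); rewrite iter_succ natr_Zp addrC subrK.
Qed.

Lemma full_index (A : finType) (f : A -> A) : (1 < #|A|)%N -> full f ->
  exists2 phi : A -> 'Z_#|A|, bijective phi & forall a, phi (f a) = phi a + 1.
Proof.
move=> A1 Hf; have /card_gt0P [a0 _] := ltnW A1.
pose psi (k : 'Z_#|A|) := iter (val k) f a0.
have psiS k : psi (k + 1) = f (psi k).
  rewrite /psi /=; move: (nat_of_ord k) => j; rewrite Zp_cast //.
  by rewrite -iterS [RHS]full_iter_mod // modnDmr addn1.
have psi_surj a : exists k, psi k = a.
  have [k <-] := Hf a0 a; exists (inZp k).
  by rewrite /psi /= Zp_cast // -full_iter_mod.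
have psi_inj : injective psi.
  apply/injectiveP/(@leq_size_uniq _ (enum A)); rewrite ?enum_uniq //.
    by move=> a _; have [k <-] := psi_surj a; apply: codom_f.
  by rewrite size_map -!cardE card_ord Zp_cast.
have cardE : #|A| = #|'Z_#|A| | by rewrite card_ord Zp_cast.
have [phi psiK phiK] := inj_card_bij psi_inj (eq_leq cardE).
exists phi; first by exists psi.
by move=> a; rewrite -{1}(phiK a) -psiS psiK.
Qed.

Lemma skew_one (T K X : finType) (rho : T -> K) (chi : T -> X) (f : T -> T)
    (r : K -> K) (h : K -> X -> X) (k0 : K) :
  bijective (fun t => (rho t, chi t)) ->
  (forall t, rho (f t) = r (rho t) /\ chi (f t) = h (rho t) (chi t)) ->
  full r -> (forall k, k != k0 -> h k =1 id) -> full (h k0) -> full f.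
Proof.
move=> b Hf Hr h1 h0.
apply: (skew_full (M := nat) (C := fun g _ => g =1 id) (k0 := k0) (a := fun=> 0%N)
  b Hf Hr) => //.
- by move=> g g' _ e Hg x; rewrite -e Hg.
- by move=> g g' _ _ Hg Hg' x; rewrite /= Hg' Hg.
- by move=> F HF; apply: full_eq h0 => x; rewrite /= HF.
Qed.

(** Changing the step at the points of a single diagonal class makes both
    directions of a torus walk through everything: the class is met once in [N]
    steps, and successive meetings differ by one full turn. *)
Lemma diag_full_snd (A B : finType) (N : nat) (phi : A -> 'Z_N) (psi : B -> 'Z_N)
    (al : A -> A) (be : B -> B) :
  bijective phi -> (forall a, phi (al a) = phi a + 1) ->
  (forall b, psi (be b) = psi b + 1) -> full be ->
  full (fun p : A * B => if phi p.1 + psi p.2 == 0 then (p.1, be p.2) else (al p.1, p.2)).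
Proof.
move=> [phi' phiK phi'K] phiS psiS Hbe.
apply: (skew_one (rho := fun p => phi p.1 + psi p.2) (chi := fun p : A * B => p.2)
  (h := fun k b => if k == 0 then be b else b) (k0 := 0) _ _ (full_succ (p := N))).
- exists (fun q => (phi' (q.1 - psi q.2), q.2)) => [[a b]|[k b]] /=.
    by rewrite addrK phiK.
  by rewrite phi'K subrK.
- move=> [a b] /=; case: ifP => _ /=; first by rewrite psiS addrA.
  by rewrite phiS addrAC.
- by move=> k /negbTE kn b; rewrite kn.
- by rewrite eqxx.
Qed.

Lemma diag_full_fst (A B : finType) (N : nat) (phi : A -> 'Z_N) (psi : B -> 'Z_N)
    (al : A -> A) (be : B -> B) :
  bijective psi -> (forall a, phi (al a) = phi a + 1) ->
  (forall b, psi (be b) = psi b + 1) -> full al ->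
  full (fun p : A * B => if phi p.1 + psi p.2 == 0 then (al p.1, p.2) else (p.1, be p.2)).
Proof.
move=> bpsi phiS psiS Hal.
apply: (full_map (h := fun p : B * A => (p.2, p.1)) _ _
  (diag_full_snd bpsi psiS phiS Hal)) => [[a b]|[b a]] /=; first by exists (b, a).
by rewrite addrC; case: ifP.
Qed.

(** Triangular maps of a product. They compose, and [n] is additive under
    composition: going once through [B] one meets every value of [H], so that
    only the total of [H] matters in the end. *)
Definition tri (X A B : finType) (pb : X -> B) (pa : X -> A) (be : B -> B)
    (al : A -> A) (f : X -> X) (n : nat * nat) : Prop :=
  exists2 H : B -> nat, (\sum_b H b)%N = n.2 &
    forall x, pb (f x) = iter n.1 be (pb x) /\ pa (f x) = iter (H (pb x)) al (pa x).

Section Tri.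
Variables (X A B : finType) (pb : X -> B) (pa : X -> A) (be : B -> B) (al : A -> A).
Hypotheses (bij : bijective (fun x => (pb x, pa x))) (Hbe : full be) (Hal : full al).

Lemma tri_ext f g n : f =1 g -> tri pb pa be al f n -> tri pb pa be al g n.
Proof. by move=> e [H s Hf]; exists H => // x; rewrite -e. Qed.

Lemma tri_id : tri pb pa be al id (0%N, 0%N).
Proof. by exists (fun=> 0%N) => //; rewrite sum_nat_const muln0. Qed.

Lemma tri_comp f g n n' :
  tri pb pa be al f n -> tri pb pa be al g n' ->
  tri pb pa be al (g \o f) (n.1 + n'.1, n.2 + n'.2)%N.
Proof.
move=> [H s Hf] [H' s' Hg].
exists (fun b => H' (iter n.1 be b) + H b)%N => [|x] /=; last first.
  have [e1 e2] := Hf x; have [e3 e4] := Hg (f x).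
  by rewrite e3 e4 e1 e2 addnC !iterD.
rewrite big_split /= addnC s; congr (_ + _)%N; rewrite -s' [RHS](reindex_inj (h := iter n.1 be)) //.
elim: n.1 => [|k IH] x y //= /(full_inj Hbe); exact: IH.
Qed.

Lemma tri_full f n :
  coprime n.1 #|B| -> coprime n.2 #|A| -> tri pb pa be al f n -> full f.
Proof.
move=> c1 c2 [H s Hf] x0; move: x0 (x0) => x0.
apply: (skew_full (M := nat) (C := fun g k => g =1 iter k al) (k0 := pb x0)
  (h := fun b => iter (H b) al)
  (a := fun b => if b == pb x0 then 0%N else H b) bij Hf (full_iter Hbe c1)) => //.
- by move=> g g' k e Hg x; rewrite -e Hg.
- by move=> g g' k k' Hg Hg' x; rewrite /= Hg' Hg addrC -iterD.
- by rewrite eqxx.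
- by move=> k /negbTE kn; rewrite kn.
- move=> F HF; apply: (full_eq (f := iter n.2 al)); last exact: full_iter.
  move=> x; rewrite /= HF -iterD; congr iter; rewrite -s (bigD1 (pb x0)) //= addnC.
  congr (_ + _)%N; rewrite [RHS](bigD1 (pb x0)) //= eqxx add0r.
  by apply: eq_bigr => b /negbTE kn; rewrite kn.
Qed.

Lemma skew_tri (T K : finType) (rho : T -> K) (chi : T -> X) (f : T -> T)
    (r : K -> K) (h : K -> X -> X) (n : K -> nat * nat) :
  bijective (fun t => (rho t, chi t)) ->
  (forall t, rho (f t) = r (rho t) /\ chi (f t) = h (rho t) (chi t)) ->
  full r -> (forall k, tri pb pa be al (h k) (n k)) ->
  coprime (\sum_k (n k).1)%N #|B| -> coprime (\sum_k (n k).2)%N #|A| -> full f.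
Proof.
move=> b Hf Hr Hh c1 c2 t0; move: t0 (t0) => t0.
pose k0 := rho t0.
apply: (skew_full (M := (nat * nat)%type) (C := tri pb pa be al) (k0 := k0)
  (a := fun k => if k == k0 then 0 else n k) b Hf Hr).
- by move=> g g' k; apply: tri_ext.
- exact: tri_id.
- by move=> g g' k k'; apply: tri_comp.
- by rewrite eqxx.
- by move=> k /negbTE kn; rewrite kn.
- move=> F HF; have := tri_comp (Hh k0) HF; apply: tri_full => /=.
    rewrite (bigD1 k0) //= in c1; apply: etrans c1; congr (coprime (_ + _) _).
    rewrite (bigD1 k0) //= eqxx add0r.
    rewrite (eq_bigr n) => [|k /negbTE kn]; last by rewrite kn.
    by elim/big_rec2: _ => // i p q _ <-.
  rewrite (bigD1 k0) //= in c2; apply: etrans c2; congr (coprime (_ + _) _).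
  rewrite (bigD1 k0) //= eqxx add0r.
  rewrite (eq_bigr n) => [|k /negbTE kn]; last by rewrite kn.
  by elim/big_rec2: _ => // i p q _ <-.
Qed.
End Tri.

Definition reach (T : Type) (f : T -> T) x y := exists k, iter k f x = y.

Lemma reach0 (T : Type) (f : T -> T) x : reach f x x.
Proof. by exists 0%N. Qed.

Lemma reach1 (T : Type) (f : T -> T) x : reach f x (f x).
Proof. by exists 1%N. Qed.

Lemma reach_trans (T : Type) (f : T -> T) y x z :
  reach f x y -> reach f y z -> reach f x z.
Proof. by move=> [k <-] [l <-]; exists (l + k)%N; rewrite iterD. Qed.

(** For maps whose orbits are too irregular for a skew product over a known
    cycle: it is enough to follow the orbit from one point of a section to the
    next. *)
Lemma full_section (T B : Type) (f : T -> T) (be : B -> B) (sec : B -> T) :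
  full be -> (forall b, reach f (sec b) (sec (be b))) ->
  (forall t, exists b, reach f (sec b) t) -> (forall t, exists b, reach f t (sec b)) ->
  full f.
Proof.
move=> Hbe Hs Hto Hfrom x y; have [b Hb] := Hfrom x; have [b' Hb'] := Hto y.
apply: reach_trans Hb (reach_trans _ Hb'); have [k <-] := Hbe b b'.
elim: k => [|k IH] /=; first exact: reach0.
exact: reach_trans IH (Hs _).
Qed.

(** Here each row is swept by a full cycle of its own, and is left at one fixed
    column only. Entering and leaving a row at the same column forces a
    complete sweep, whichever cycle is used; so the cycles of different rows
    need have nothing in common. *)
Lemma sweep_full (A B : finType) (ga : B -> A -> A) (be : B -> B) (a0 : A) :
  (forall b, full (ga b)) -> full be ->
  full (fun p : A * B => if p.1 == a0 then (ga (be p.2) p.1, be p.2) else (ga p.2 p.1, p.2)).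
Proof.
move=> Hga Hbe; set f := (fun p => _).
have row b j : reach f (a0, b) (iter j.+1 (ga (be b)) a0, be b).
  elim: j => [|j IH]; first by exists 1%N; rewrite /= /f /= eqxx.
  have [e|/negbTE ne] := eqVneq (iter j.+1 (ga (be b)) a0) a0.
    by rewrite iterS e; exists 1%N; rewrite /= /f /= eqxx.
  by apply: reach_trans IH _; exists 1%N; rewrite [iter j.+2 _ _]iterS /= /f /= -iterS ne.
have to b a : reach f (a0, b) (a, be b).
  have [j <-] := Hga (be b) (ga (be b) a0) a; rewrite -iterSr; exact: row.
apply: (full_section (be := be) (sec := fun b => (a0, b))) => //.
- move=> [a b]; have [be' _ beK] := full_bij Hbe.
  by exists (be' b); rewrite -{2}(beK b).
- move=> [a b]; exists b; have [k Hk] := Hga b a a0.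
  elim: k a Hk => [|k IH] a; first by move=> /= ->; apply: reach0.
  rewrite iterSr => /IH Hk; have [->|/negbTE ne] := eqVneq a a0; first exact: reach0.
  by apply: reach_trans Hk; exists 1%N; rewrite /= /f /= ne.
Qed.

(** * Recolourings of directed tori *)

(** The points are allowed to be relabelled, so that products and layers of tori
    are tori again without any change of the underlying type. *)
Definition toroidal (m : nat) (I T : finType) (de : I -> T -> T) : Prop :=
  exists2 Phi : T -> {ffun I -> 'Z_m}, bijective Phi &
    forall i t, Phi (de i t) = Phi t + [ffun j => (j == i)%:R].

Definition recoloring (I T : finType) (de ga : I -> T -> T) : Prop :=
  exists2 ka : T -> I -> I, forall t, injective (ka t) &
    forall i t, ga i t = de (ka t i) t.

(** The directions are permuted at each point, hence the colours [ga i] use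
    every arc exactly once; they are the Hamilton cycles. *)
Definition decomposes (m : nat) (I : finType) : Prop :=
  exists (T : finType) (de ga : I -> T -> T),
    [/\ toroidal m de, recoloring de ga & forall i, full (ga i)].

Section Systems.
Variable m : nat.
Hypothesis m_gt1 : (1 < m)%N.

Lemma card_Zm : #|'Z_m| = m.
Proof. by rewrite card_ord Zp_cast. Qed.

Lemma toroidal_card (I T : finType) (de : I -> T -> T) :
  toroidal m de -> #|T| = (m ^ #|I|)%N.
Proof. by move=> [Phi /bij_eq_card -> _]; rewrite card_ffun card_Zm. Qed.

Lemma recoloring_refl (I T : finType) (de : I -> T -> T) : recoloring de de.
Proof. by exists (fun=> id) => // t i j. Qed.

Lemma recoloring_trans (I T : finType) (de ga et : I -> T -> T) :
  recoloring de ga -> recoloring ga et -> recoloring de et.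
Proof.
move=> [ka ki Hk] [la li Hl]; exists (fun t i => ka t (la t i)) => [t i j /ki /li //|i t].
by rewrite Hl Hk.
Qed.

(** Every step of a torus raises the sum of the coordinates by one, and
    recolouring does not affect this. *)
Lemma toroidal_degree (I T : finType) (de ga : I -> T -> T) :
  toroidal m de -> recoloring de ga ->
  exists deg : T -> 'Z_m, forall i t, deg (ga i t) = deg t + 1.
Proof.
move=> [Phi _ HPhi] [ka _ Hka]; exists (fun t => \sum_i Phi t i) => i t.
rewrite Hka HPhi; under eq_bigr do rewrite !ffunE.
rewrite big_split /=; congr (_ + _); rewrite (bigD1 (ka t i)) //= eqxx big1 ?addr0 //.
by move=> j /negbTE ->.
Qed.

Definition box (I J T U : finType) (de : I -> T -> T) (de' : J -> U -> U)
    (k : I + J) (p : T * U) : T * U :=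
  match k with inl i => (de i p.1, p.2) | inr j => (p.1, de' j p.2) end.

Lemma toroidal_box (I J T U : finType) (de : I -> T -> T) (de' : J -> U -> U) :
  toroidal m de -> toroidal m de' -> toroidal m (box de de').
Proof.
move=> [P [P' PK P'K] HP] [Q [Q' QK Q'K] HQ].
exists (fun p => [ffun k => match k with inl i => P p.1 i | inr j => Q p.2 j end]).
  exists (fun F : {ffun I + J -> 'Z_m} =>
            (P' [ffun i => F (inl i)], Q' [ffun j => F (inr j)])).
    move=> [t u] /=; congr (_, _).
      by rewrite -[RHS]PK; congr P'; apply/ffunP=> i; rewrite !ffunE.
    by rewrite -[RHS]QK; congr Q'; apply/ffunP=> i; rewrite !ffunE.
  by move=> F; apply/ffunP => [[i|j]]; rewrite ffunE /= ?P'K ?Q'K ffunE.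
by move=> [i|j] [t u]; apply/ffunP => [[i'|j']]; rewrite !ffunE /= ?HP ?HQ ?ffunE //= addr0.
Qed.

Lemma recoloring_box (I J T U : finType) (de ga : I -> T -> T) (de' ga' : J -> U -> U) :
  recoloring de ga -> recoloring de' ga' -> recoloring (box de de') (box ga ga').
Proof.
move=> [ka ki Hk] [la li Hl].
exists (fun p k => match k with inl i => inl (ka p.1 i) | inr j => inr (la p.2 j) end).
  by move=> p [i|j] [i'|j'] // [] => [/ki ->|/li ->].
by move=> [i|j] p /=; rewrite ?Hk ?Hl.
Qed.

(** Adding one direction to a torus, and measuring the new coordinate by the
    total degree: then every step advances the new coordinate, and the new
    direction does nothing else. *)
Definition layered (I T : finType) (de : I -> T -> T) (o : option I) (p : 'Z_m * T) :
    'Z_m * T :=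
  (p.1 + 1, if o is Some i then de i p.2 else p.2).

Lemma toroidal_layered (I T : finType) (de : I -> T -> T) :
  toroidal m de -> toroidal m (layered de).
Proof.
move=> tor; have [Phi [Psi PK KP] HPhi] := tor.
have [deg Hdeg] := toroidal_degree tor (recoloring_refl de).
exists (fun p => [ffun o => if o is Some i then Phi p.2 i else p.1 - deg p.2]).
  exists (fun F : {ffun option I -> 'Z_m} => 
      let t := Psi [ffun i => F (Some i)] in (F None + deg t, t)).
    move=> [s t] /=; set t' := Psi _.
    have -> : t' = t.
      by rewrite /t' -[RHS]PK; congr Psi; apply/ffunP => i; rewrite !ffunE.
    by rewrite ffunE subrK.
  by move=> F; apply/ffunP => [[i|]]; rewrite ffunE /= ?addrK ?KP ?ffunE.
move=> [i|] [s t]; apply/ffunP => [[j|]]; rewrite !ffunE /= ?HPhi ?ffunE ?addr0 //.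
  by rewrite Hdeg opprD addrACA subrr addr0.
by rewrite addrAC.
Qed.

Lemma recoloring_layered (I T : finType) (de ga : I -> T -> T) :
  recoloring de ga -> recoloring (layered de) (layered ga).
Proof.
move=> [ka ki Hk].
exists (fun p o => if o is Some i then Some (ka p.2 i) else None).
  by move=> p [i|] [j|] // [] /ki ->.
by move=> [i|] [s t] //=; rewrite /layered /= Hk.
Qed.

Lemma decomposes_card (I J : finType) : #|I| = #|J| -> decomposes m I -> decomposes m J.
Proof.
move=> e [T [de [ga [[Phi [Psi PK KP] HPhi] [ka ki Hk] Hfull]]]].
pose g (j : J) : I := enum_val (cast_ord (esym e) (enum_rank j)).
pose g' (i : I) : J := enum_val (cast_ord e (enum_rank i)).
have gK : cancel g g' by move=> j; rewrite /g /g' enum_valK cast_ordKV enum_rankK.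
have g'K : cancel g' g by move=> i; rewrite /g /g' enum_valK cast_ordK enum_rankK.
exists T, (fun j => de (g j)), (fun j => ga (g j)); split=> [||j]; last exact: Hfull.
- exists (fun t => [ffun j => Phi t (g j)]).
    exists (fun F : {ffun J -> 'Z_m} => Psi [ffun i => F (g' i)]) => [t|F].
      by rewrite -[RHS]PK; congr Psi; apply/ffunP=> i; rewrite !ffunE g'K.
    by apply/ffunP=> j; rewrite ffunE KP ffunE gK.
  by move=> j t; apply/ffunP=> k; rewrite !ffunE HPhi !ffunE (can_eq gK).
- exists (fun t j => g' (ka t (g j))) => [t j k /(can_inj g'K) /ki /(can_inj gK) //|j t].
  by rewrite g'K Hk.
Qed.

Lemma decomposes_unit : decomposes m unit.
Proof.
exists 'Z_m, (fun _ s => s + 1), (fun _ s => s + 1); split; last by move=> _; apply: full_succ.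
  exists (fun s => [ffun=> s]).
    exists (fun F : {ffun unit -> 'Z_m} => F tt) => [s|F]; first by rewrite ffunE.
    by apply/ffunP => [[]]; rewrite ffunE.
  by move=> [] s; apply/ffunP => [[]]; rewrite !ffunE.
exact: recoloring_refl.
Qed.

(** The two copies of colour [i] exchange their roles on one diagonal class of
    the product of the two cycles of this colour. The diagonals of different
    colours are unrelated, but the exchanges do not interfere: each of them
    concerns one pair of colours. *)
Lemma decomposes_double (I : finType) : decomposes m I -> decomposes m (I + I)%type.
Proof.
move=> [T [de [ga [tor rec Hfull]]]].
have [I0|/card_gt0P [i0 _]] := posnP #|I|.
  by apply: (decomposes_card (I := I)); [rewrite card_sum I0 | exists T, de, ga].
have T1 : (1 < #|T|)%N.
  by rewrite (toroidal_card tor) -{1}(exp1n #|I|) ltn_exp2r //; apply/card_gt0P; exists i0.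
have [phi phiP H] := fin_all_exists2 (fun i => full_index T1 (Hfull i)).
pose D i (p : T * T) := phi i p.1 + phi i p.2 == 0.
pose ka (p : T * T) (k : I + I) : I + I :=
  match k with
  | inl i => if D i p then inr i else inl i
  | inr i => if D i p then inl i else inr i
  end.
exists (T * T)%type, (box de de), (fun k p => box ga ga (ka p k) p); split.
- exact: toroidal_box.
- apply: recoloring_trans (recoloring_box rec rec) _; exists ka => // p.
  by move=> [i|i] [j|j] /=; case: ifP => Di; case: ifP => Dj // [] e;
     move: Di Dj; rewrite e => ->.
- move=> [i|i].
    apply: full_eq (diag_full_snd (phiP i) (H i) (H i) (Hfull i)) => [[a b]] /=.
    by rewrite /D /=; case: ifP.
  apply: full_eq (diag_full_fst (phiP i) (H i) (H i) (Hfull i)) => [[a b]] /=.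
  by rewrite /D /=; case: ifP.
Qed.
End Systems.

(** * An odd recolouring of the plane *)

Definition step (m : nat) (o : option bool) : 'Z_m * 'Z_m :=
  match o with None => 0 | Some false => (1, 0) | Some true => (0, 1) end.

(** The translations of the plane are even permutations, so for even [m] the
    last condition makes each colour of [E] an odd one. In a torus containing a
    plane factor, [E] is used over one point of the remaining coordinates and the
    constant recolourings [c 1], ..., [c m.-1] over [m - 1] others; their
    translations complete it to a single cycle. The condition on [Some true]
    keeps its colour from moving in the first coordinate at these points, which
    leaves room for a shear of the plane in that colour. *)
Definition odd_plane (m : nat) : Prop :=
  exists (E : 'Z_m * 'Z_m -> option bool -> option bool)
         (c : nat -> option bool -> option bool),
    [/\ forall x, injective (E x), forall r, injective (c r),
        forall r, c r (Some true) != Some false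
      & forall z, full (fun x => x + step m (E x z) + \sum_(1 <= r < m) step m (c r z))].

(** Leaving every second point of an initial run aside, and returning for them
    at the end of the turn, still sweeps a whole row provided that the run has
    even length. *)
Lemma row_sweep (T : Type) (f : T -> T) (P : nat -> T) (N k : nat) :
  (k < N)%N -> ~~ odd k -> P N = P 0%N ->
  (forall t, (t < k)%N -> f (P t) = P t.+2) ->
  (forall t, (k < t < N)%N -> f (P t) = P t.+1) ->
  forall t, (t < N)%N -> reach f (P 1%N) (P t) /\ reach f (P t) (P k).
Proof.
move=> kN ev PN f2 f1.
have s2 i j : (i + 2 * j <= k.+1)%N -> reach f (P i) (P (i + 2 * j)%N).
  elim: j => [|j IH] ij; first by rewrite muln0 addn0; apply: reach0.
  apply: reach_trans (IH _) _; first by lia.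
  by rewrite (_ : (i + 2 * j.+1 = (i + 2 * j).+2)%N) -?f2; [apply: reach1|lia|lia].
have s1 i j : (k < i)%N -> (i + j <= N)%N -> reach f (P i) (P (i + j)%N).
  move=> ki; elim: j => [|j IH] ij; first by rewrite addn0; apply: reach0.
  apply: reach_trans (IH _) _; first by lia.
  by rewrite addnS -f1; [apply: reach1|lia].
have kl : k = (2 * k./2)%N by lia.
have r1k : reach f (P 1%N) (P k.+1) by rewrite {1}kl -add1n; apply: s2; lia.
have rkN i : (k < i <= N)%N -> reach f (P i) (P 0%N).
  by move=> ki; have := s1 i (N - i)%N; rewrite subnKC ?PN; [apply; lia|lia].
have r0 t : (t <= k)%N -> ~~ odd t -> reach f (P 0%N) (P t).
  by move=> tk te; rewrite (_ : t = (0 + 2 * t./2)%N); [apply: s2; lia|lia].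
move=> t tN; case: (leqP t k) => tk; case: (boolP (odd t)) => ot; split.
- by rewrite (_ : t = (1 + 2 * t./2)%N); [apply: s2; lia|lia].
- apply: reach_trans (reach_trans (rkN k.+1 _) (r0 k _ _)) => //; last by lia.
  by rewrite (_ : k.+1 = (t + 2 * (k.+1 - t)./2)%N); [apply: s2; lia|lia].
- by apply: reach_trans r1k (reach_trans (rkN k.+1 _) (r0 t _ _)) => //; lia.
- by rewrite {1}(_ : k = (t + 2 * (k - t)./2)%N); [apply: s2; lia|lia].
- apply: reach_trans r1k _; have := s1 k.+1 (t - k.+1)%N.
  by rewrite subnKC //; apply; lia.
- by apply: reach_trans (rkN t _) (r0 k _ _) => //; lia.
- apply: reach_trans r1k _; have := s1 k.+1 (t - k.+1)%N.
  by rewrite subnKC //; apply; lia.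
- by apply: reach_trans (rkN t _) (r0 k _ _) => //; lia.
Qed.

Lemma val_succ (m : nat) (r : 'Z_m) : (1 < m)%N -> ((r + 1)%R : nat) = (r.+1 %% m)%N.
Proof. by move=> m1 /=; move: (nat_of_ord r) => j; rewrite Zp_cast // modnDmr addn1. Qed.

Section Staircase.
Variables (m R1 R2 A1 A2 : nat).
Hypotheses (m_gt1 : (1 < m)%N) (R12 : (0 < R1 < R2)%N) (R2m : (R2 < m)%N)
  (A12 : (0 < A1 < A2)%N) (A2m : (A2 < m)%N)
  (evA1 : ~~ odd A1) (evA2 : ~~ odd A2) (evm : ~~ odd m).

(** Row [r] is left at column [A1], [A2] or [0], according to the position of
    [r] with respect to [R1] and [R2]. *)
Definition stair_exit (x r : nat) : bool :=
  [|| (r < R1) && (x == A1), (R1 <= r < R2) && (x == A2) | (R2 <= r) && (x == 0)]%N.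

(** The runs joining consecutive exits, where steps are doubled. *)
Definition stair_run (x r : nat) : bool :=
  [|| (r == 0) && (x < A1), (r == R1) && (A1 <= x < A2) | (r == R2) && (A2 <= x)]%N.

Definition stair (x r : nat) : option bool :=
  if stair_exit x r then Some true else if stair_run x r then Some false else None.

Definition stair_map (p : 'Z_m * 'Z_m) : 'Z_m * 'Z_m :=
  match stair p.1 p.2 with
  | None => (p.1 + 1, p.2)
  | Some false => (p.1 + 2%:R, p.2)
  | Some true => (p.1 + 1, p.2 + 1)
  end.

(** Each row is swept before its exit is reached, as all runs have even length,
    and each exit leads to the successor of the entrance of the next row. *)
Lemma stair_full : full stair_map.
Proof.
have [/andP [R1_gt0 R12'] /andP [A1_gt0 A12']] := (R12, A12).
have A1m := ltn_trans A12' A2m; have m_gt0 := ltnW m_gt1.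
pose e (r : nat) := (if R2 <= r then 0 else if r < R1 then A1 else A2)%N.
pose a (r : nat) := if r is r'.+1 then e r' else 0%N.
pose k (r : nat) :=
  (if r == 0 then A1 else if r == R1 then A2 - A1 else if r == R2 then m - A2 else 0)%N.
pose P (r : 'Z_m) (t : nat) : 'Z_m * 'Z_m := ((a r + t)%:R, r).
have rm (r : 'Z_m) : (r < m)%N by have := ltn_ord r; rewrite {2}Zp_cast.
have em j : (e j < m)%N by rewrite /e; case: ifP => // _; case: ifP.
have am j : (a j < m)%N by case: j.
have kev j : ~~ odd (k j).
  rewrite /k; case: eqP => // _; case: eqP => _.
    by rewrite oddB ?(ltnW A12') // (negbTE evA1) (negbTE evA2).
  by case: eqP => // _; rewrite oddB ?(ltnW A2m) // (negbTE evm) (negbTE evA2).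
have aS j : (j < m)%N -> a (j.+1 %% m)%N = e j.
  move=> jm; have [jm1|jm1] := ltnP j.+1 m; first by rewrite modn_small.
  have -> : j.+1 = m by apply/eqP; rewrite eqn_leq jm.
  by rewrite modnn /e -ltnS (leq_trans R2m).
have exitE x j : stair_exit x j = (x == e j).
  rewrite /stair_exit /e; case: (ltnP j R1) => j1.
    by rewrite [(R2 <= j)%N]leqNgt (ltn_trans j1 R12') !orbF.
  by case: (ltnP j R2); rewrite /= ?orbF.
have at_R1 j : j.+1 = R1 -> [/\ (R2 <= j)%N = false, (j < R1)%N & (R2 <= j.+1)%N = false].
  move=> e1; have j1 : (j < R1)%N by rewrite -e1.
  by split=> //; apply/negbTE; rewrite -ltnNge ?(ltn_trans j1) // e1.
have at_R2 j : j.+1 = R2 -> [/\ (R2 <= j)%N = false, (j < R1)%N = false & (R2 <= j.+1)%N].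
  move=> e2; split; last by rewrite e2.
    by apply/negbTE; rewrite -ltnNge -e2.
  by apply/negbTE; rewrite -leqNgt -ltnS e2.
(* the run of row [j] starts at the entrance and ends at the exit *)
have akE j : (k j < m)%N /\ ((a j + k j = e j)%N \/ (e j = 0 /\ a j + k j = m)%N).
  rewrite /k; case: j => [|j] /=; first split=> //.
    by left; rewrite /e leqNgt (ltn_trans R1_gt0 R12') R1_gt0.
  case: eqP => [e1|/eqP n1].
    have [f1 f2 f3] := at_R1 j e1; rewrite /e f1 f2 f3 e1 ltnn /=.
    by split; [exact: leq_ltn_trans (leq_subr _ _) A2m | left; rewrite subnKC // ltnW].
  case: eqP => [e2|/eqP n2].
    have [f1 f2 f3] := at_R2 j e2; rewrite /e f1 f2 f3 /=; split; last first.
      by right; rewrite subnKC // ltnW.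
    by rewrite ltn_subrL (ltn_trans A1_gt0 A12').
  split=> //; left; rewrite addn0 /e.
  have -> : (R2 <= j.+1)%N = (R2 <= j)%N by rewrite leq_eqVlt [R2 == _]eq_sym (negbTE n2).
  by have -> : (j < R1)%N = (j.+1 < R1)%N by rewrite [RHS]ltn_neqAle n1.
have runE x j : (x < m)%N -> stair_run x j = (a j <= x < a j + k j)%N.
  move=> xm; rewrite /stair_run /k; case: j => [|j] /=.
    by rewrite [0%N == R1]eq_sym [0%N == R2]eq_sym !gtn_eqF ?orbF // (ltn_trans R1_gt0).
  case: eqP => [e1|/eqP n1].
    have [f1 f2 _] := at_R1 j e1; rewrite /e f1 f2 e1 ltn_eqF // orbF /=.
    by rewrite subnKC // ltnW.
  case: eqP => [e2|_]; last by rewrite /= addn0 ltnNge andbN.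
  have [f1 f2 _] := at_R2 j e2; rewrite /e f1 f2 /=.
  by rewrite subnKC ?xm ?andbT // ltnW.
have val_P (r : 'Z_m) t : (t < m)%N ->
    ((P r t).1 : nat) = (if a r + t < m then a r + t else a r + t - m)%N.
  move=> tm; rewrite /P /= val_Zp_nat //; have := am r; move: (a r) => c cm.
  case: ltnP => h; first by rewrite modn_small.
  by rewrite -{1}(subnK h) modnDr modn_small //; clear -cm tm h; lia.
have st (r : 'Z_m) t : (t < m)%N -> stair (P r t).1 (P r t).2 =
    if (t == k r)%N then Some true else if (t < k r)%N then Some false else None.
  move=> tm; have := val_P r t tm; have xm := rm (P r t).1.
  move: (nat_of_ord (P r t).1) xm => x xm; rewrite /stair exitE runE // [(P r t).2]/=.
  have := akE r; have := am r; have := em r; move: (a r) (k r) (e r) => a' k' e'.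
  move=> em' am' [km' ak'] xE.
  have -> : (x == e') = (t == k').
    by apply/eqP/eqP; clear -xm tm em' am' km' ak' xE; case: ltnP xE; lia.
  case: eqP => // tk; congr (if _ then _ else _).
  by apply/idP/idP; clear -xm tm em' am' km' ak' xE tk; case: ltnP xE; lia.
have ka j : (j < m)%N -> (a j + k j = a (j.+1 %% m))%N \/ (a j + k j = a (j.+1 %% m) + m)%N.
  by move=> jm; rewrite aS //; have [_ [->|[-> ->]]] := akE j; [left | right].
have row (r : 'Z_m) t : (t < m)%N ->
    reach stair_map (P r 1%N) (P r t) /\ reach stair_map (P r t) (P r (k r)).
  have [km _] := akE r; have evk := kev r.
  move=> tm; apply: row_sweep tm => //.
  - by rewrite /P natrD pchar_Zp // addr0 addn0.
  - move=> t' h; rewrite /stair_map (st r t' (ltn_trans h km)) (ltn_eqF h) h.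
    by rewrite /P -natrD -addnA addn2.
  - move=> t' /andP [h1 h2]; rewrite /stair_map (st r t' h2) (gtn_eqF h1) ltnNge (ltnW h1) /=.
    by rewrite /P -(natrD _ _ 1) -addnA addn1.
have kexit (r : 'Z_m) : stair_map (P r (k r)) = P (r + 1) 1%N.
  have [km _] := akE r.
  have rS : ((r + 1)%R : nat) = (r.+1 %% m)%N by exact: val_succ.
  rewrite /stair_map (st r _ km) eqxx /P rS; apply: congr2 => //=; rewrite !natrD; congr (_ + _).
  by rewrite -natrD; have [->|->] := ka _ (rm r); rewrite // natrD pchar_Zp // addr0.
have surjP x r : exists2 t, (t < m)%N & (x, r) = P r t.
  exists (nat_of_ord (x - (a r)%:R)%R); first exact: rm.
  by rewrite /P natrD natr_Zp addrC subrK.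
apply: (full_section (be := fun r => r + 1) (sec := fun r => P r 1%N)).
- exact: full_succ.
- move=> r; apply: reach_trans (row r 1%N _).2 _ => //.
  by rewrite -kexit; apply: reach1.
- by move=> [x r]; exists r; have [t tm ->] := surjP x r; apply: (row _ _ tm).1.
- move=> [x r]; exists (r + 1); have [t tm ->] := surjP x r.
  by rewrite -kexit; apply: reach_trans (row _ _ tm).2 (reach1 _ _).
Qed.
End Staircase.

Definition turn (o : option bool) : option bool :=
  match o with None => Some false | Some false => Some true | Some true => None end.

Lemma turn_inj : injective turn.
Proof. by move=> [[]|] [[]|]. Qed.

Lemma turn3 o : turn (turn (turn o)) = o.
Proof. by case: o => [[]|]. Qed.

Lemma stair_neq_turn R1 R2 A1 A2 x r R1' R2' A1' A2' x' r' :
  let ex := stair_exit R1 R2 A1 A2 x r in let run := stair_run R1 R2 A1 A2 x r in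
  let ex' := stair_exit R1' R2' A1' A2' x' r' in let run' := stair_run R1' R2' A1' A2' x' r' in
  (run -> ex' || run') -> (ex -> run' -> ex') -> (ex' -> ex || run) ->
  stair R1 R2 A1 A2 x r <> turn (stair R1' R2' A1' A2' x' r').
Proof.
move=> ex run ex' run' h1 h2 h3; rewrite /stair -/ex -/run -/ex' -/run'.
by move: h1 h2 h3; case: ex; case: run; case: ex'; case: run' => // h1 h2 h3;
   by [have := h1 isT | have := h2 isT isT | have := h3 isT].
Qed.

(** The three colours are three staircases, read in the coordinates [(i, j)],
    [(j, - i - j)] and [(- i - j, i)] and with their three kinds of steps
    shifted cyclically. Hence two of them disagree at a point as soon as the exits
    and runs of one avoid, or are met by, those of the other, as in
    [stair_neq_turn]; the corners are chosen to this end. *)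
Lemma odd_plane_ge6 (m : nat) : (6 <= m)%N -> ~~ odd m -> odd_plane m.
Proof.
move=> m6 evm; have m1 : (1 < m)%N by lia.
pose E (p : 'Z_m * 'Z_m) (z : option bool) : option bool :=
  match z with
  | None => stair 2 (m - 2) (m - 4) (m - 2) p.1 p.2
  | Some false => turn (stair 2 4 2 (m - 2) p.2 (- p.1 - p.2)%R)
  | Some true => turn (turn (stair (m - 4) (m - 2) 2 4 (- p.1 - p.2)%R p.1))
  end.
pose c (r : nat) (z : option bool) := if r == 1%N then turn z else z.
exists E, c; split.
- move=> [i j].
  have im : (i < m)%N by have := ltn_ord i; rewrite {2}Zp_cast.
  have jm : (j < m)%N by have := ltn_ord j; rewrite {2}Zp_cast.
  have [s sE] : {s | s = (- i - j)%R} by eexists.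
  have EE z : E (i, j) z = match z with
      | None => stair 2 (m - 2) (m - 4) (m - 2) i j
      | Some false => turn (stair 2 4 2 (m - 2) j s)
      | Some true => turn (turn (stair (m - 4) (m - 2) 2 4 s i)) end by rewrite sE.
  have sm : (s < m)%N by have := ltn_ord s; rewrite {2}Zp_cast.
  have ijs : (i + j + s = 0 \/ i + j + s = m \/ i + j + s = m + m)%N.
    have : ((i + j + s)%:R : 'Z_m) = 0 by rewrite !natrD !natr_Zp sE; ring.
    move/(congr1 val); rewrite /= val_Zp_nat // => /eqP /dvdnP [q].
    move: (nat_of_ord i) (nat_of_ord j) (nat_of_ord s) im jm sm => {s sE EE} i' j' s' im jm sm e.
    have q3 : (q < 3)%N by rewrite -(ltn_pmul2r (ltnW m1)) -e; lia.
    by case: q e q3 => [|[|[|q]]] //; lia.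
  have ne : [/\ stair 2 (m - 2) (m - 4) (m - 2) i j <> turn (stair 2 4 2 (m - 2) j s),
      stair (m - 4) (m - 2) 2 4 s i <> turn (stair 2 (m - 2) (m - 4) (m - 2) i j)
    & stair 2 4 2 (m - 2) j s <> turn (stair (m - 4) (m - 2) 2 4 s i)].
    move: (nat_of_ord i) (nat_of_ord j) (nat_of_ord s) im jm sm ijs.
    move=> {i j s sE EE} i j s im jm sm ijs.
    split; (apply: stair_neq_turn; rewrite /stair_exit /stair_run;
      [ move=> /or3P [] /andP [h h']
      | move=> /or3P [] /andP [h h'] /or3P [] /andP [g g']
      | move=> /or3P [] /andP [h h'] ]); lia.
  have [n1 n2 n3] := ne.
  move=> z z'; rewrite !EE.
  case: z z' => [[]|] [[]|] // e;
    by [case: n3; apply: turn_inj | case: n2; rewrite e turn3 | case: n2; rewrite -e turn3 | case: n1].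
- by move=> r z z'; rewrite /c; case: ifP => _ //; apply: turn_inj.
- by move=> r; rewrite /c; case: ifP.
- move=> z.
  (* this translation turns the three steps of [z] into those of [stair_map] *)
  have -> : \sum_(1 <= r < m) step m (c r z) = step m (turn z) - step m z *+ 2.
    rewrite big_ltn // /c eqxx; congr (_ + _); rewrite big_nat.
    under eq_bigr => r /andP [r1 _] do rewrite gtn_eqF //.
    rewrite -big_nat sumr_const_nat.
    rewrite (_ : (m - 2 = m.-2)%N); last by lia.
    have : step m z *+ (m.-2 + 2) = 0.
      by rewrite (_ : (m.-2 + 2 = m)%N); [case: z => [[]|]; rewrite pairMnE /= ?mul0rn ?pchar_Zp | lia].
    by rewrite mulrnDr => /eqP; rewrite addr_eq0 => /eqP ->.
  pose h (q : 'Z_m * 'Z_m) : 'Z_m * 'Z_m :=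
    match z with
    | None => q | Some false => (- q.1 - q.2, q.1) | Some true => (q.2, - q.1 - q.2)
    end.
  have h_surj y : exists q, h q = y.
    case: y => i j; rewrite /h; case: z {h} => [[]|].
    - by exists (- i - j, i); congr (_, _); rewrite /=; ring.
    - by exists (j, - i - j); congr (_, _); rewrite /=; ring.
    - by exists (i, j).
  have opK (x r : 'Z_m) : - (- x - r) - x = r by ring.
  have opK' (x r : 'Z_m) : - r - (- x - r) = x by ring.
  have done_pair (x y x' y' : 'Z_m) : x = x' -> y = y' -> (x, y) = (x', y').
    by move=> -> ->.
  case: z @h h_surj => [[]|] h h_surj.
  - apply: (full_map (h := h) (f := stair_map (m - 4) (m - 2) 2 4)) => //.
      move=> [x r].
      have -> : E (h (x, r)) (Some true) = turn (turn (stair (m - 4) (m - 2) 2 4 x r)).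
        by rewrite -[in RHS](opK' x r).
      rewrite /stair_map [(x, r).1]/= [(x, r).2]/= /h.
      by case: stair => [[]|]; rewrite /step pairMnE; apply: done_pair => /=; ring.
    by apply: stair_full => //; lia.
  - apply: (full_map (h := h) (f := stair_map 2 4 2 (m - 2))) => //.
      move=> [x r].
      have -> : E (h (x, r)) (Some false) = turn (stair 2 4 2 (m - 2) x r).
        by rewrite -[in RHS](opK x r).
      rewrite /stair_map [(x, r).1]/= [(x, r).2]/= /h.
      by case: stair => [[]|]; rewrite /step pairMnE; apply: done_pair => /=; ring.
    by apply: stair_full => //; lia.
  - apply: (full_map (h := h) (f := stair_map 2 (m - 2) (m - 4) (m - 2))) => //.
      move=> [x r]; rewrite /h /E /stair_map [(x, r).1]/= [(x, r).2]/=.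
      by case: stair => [[]|]; rewrite /step pairMnE; apply: done_pair => /=; ring.
    by apply: stair_full => //; lia.
Qed.

(** For [m = 4] there is no room for three staircases; here is an odd
    recolouring of the sixteen points, the [i]-th row of each table listing the
    colours of the points [(i, 0)], ..., [(i, 3)]. *)
Definition table (l : seq (seq nat)) (p : 'Z_4 * 'Z_4) : option bool :=
  match nth 0 (nth [::] l p.1) p.2 with
  | 0 => None | 1 => Some false | _ => Some true
  end%N.

Lemma odd_plane_4 : odd_plane 4.
Proof.
pose E (p : 'Z_4 * 'Z_4) (z : option bool) :=
  table (match z with
  | None => [:: [:: 1; 2; 2; 2]; [:: 2; 1; 0; 0]; [:: 0; 1; 0; 0]; [:: 0; 1; 0; 0]]
  | Some false => [:: [:: 0; 0; 1; 0]; [:: 1; 0; 2; 2]; [:: 2; 2; 2; 1]; [:: 2; 2; 1; 2]]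
  | Some true => [:: [:: 2; 1; 0; 1]; [:: 0; 2; 1; 1]; [:: 1; 0; 1; 2]; [:: 1; 0; 2; 1]]
  end%N) p.
pose c (r : nat) (z : option bool) : option bool :=
  match z with
  | None => Some (r != 1)%N
  | Some false => if r == 1%N then None else Some false
  | Some true => if r == 1%N then Some true else None
  end.
exists E, c; split.
- move=> [[i im] [j jm]].
  case: i im => [|[|[|[|i]]]] // im; case: j jm => [|[|[|[|j]]]] // jm;
    by move=> [[]|] [[]|].
- by move=> r [[]|] [[]|]; rewrite /c; case: (r == 1%N).
- by move=> r; rewrite /c; case: (r == 1%N).
- move=> z.
  have -> : \sum_(1 <= r < 4) step 4 (c r z) = step 4 (c 1%N z) + step 4 (c 2%N z) *+ 2.
    by rewrite big_ltn // big_ltn // big_ltn // big_geq // addr0 mulr2n.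
  pose code (p : 'Z_4 * 'Z_4) := (4 * p.1 + p.2)%N.
  pose pt (j : nat) : 'Z_4 * 'Z_4 := (inZp (j %/ 4), inZp j).
  have code_lt p : (code p < 16)%N.
    case: p => i j; rewrite /code /=.
    by have := ltn_ord i : (i < 4)%N; have := ltn_ord j : (j < 4)%N; lia.
  have code_inj : injective code.
    move=> [i j] [i' j']; rewrite /code /= => e.
    have := ltn_ord j : (j < 4)%N; have := ltn_ord j' : (j' < 4)%N => h h'.
    by congr (_, _); apply: val_inj => /=; lia.
  have codeK p : pt (code p) = p.
    apply: code_inj; have := code_lt p; move: (code p) => j j16.
    by apply/eqP; move: j16; do 16! [case: j => [|j] //].
  have visit (l : seq nat) (f : 'Z_4 * 'Z_4 -> 'Z_4 * 'Z_4) :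
      [&& size l == 16%N, all (fun j => j \in l) (iota 0 16)
        & all (fun k => code (f (pt (nth 0%N l k))) == code (pt (nth 0%N l (k.+1 %% 16))))
              (iota 0 16)] -> full f.
    move=> /and3P [/eqP sl /allP Hl /allP Hf].
    apply: (full_map (h := fun k : 'Z_16 => pt (nth 0%N l k)) _ _ (full_succ (p := 16))).
    + move=> p; have pl : code p \in l by apply: Hl; rewrite mem_iota code_lt.
      have ix : (index (code p) l < 16)%N by rewrite -sl index_mem.
      by exists (Ordinal ix : 'Z_16); rewrite /= nth_index ?codeK.
    + move=> k; apply/esym/code_inj/eqP; rewrite val_succ //; apply: Hf.
      by rewrite mem_iota; have := ltn_ord k.
  case: z => [[]|].
  + by apply: (visit [:: 0; 2; 3; 4; 5; 7; 8; 13; 14; 12; 1; 6; 11; 9; 10; 15]%N); vm_compute.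
  + by apply: (visit [:: 0; 8; 1; 9; 2; 14; 10; 3; 11; 7; 12; 5; 13; 6; 15; 4]%N); vm_compute.
  + by apply: (visit [:: 0; 10; 12; 2; 5; 15; 1; 4; 11; 13; 7; 9; 3; 6; 8; 14]%N); vm_compute.
Qed.

(** * Three directions *)

Definition plane (m : nat) (b : bool) (x : 'Z_m * 'Z_m) := x + step m (Some b).

Lemma toroidal_plane (m : nat) : toroidal m (@plane m).
Proof.
exists (fun x => [ffun b : bool => if b then x.2 else x.1]).
  exists (fun F : {ffun bool -> 'Z_m} => (F false, F true)).
    by move=> [i j]; rewrite !ffunE.
  by move=> F; apply/ffunP => [[]]; rewrite ffunE.
by move=> [] [i j]; apply/ffunP => [[]]; rewrite !ffunE /= ?addr0.
Qed.

Lemma layered_planeE (m : nat) o (p : 'Z_m * ('Z_m * 'Z_m)) :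
  layered (@plane m) o p = (p.1 + 1, p.2 + step m o).
Proof. by case: o => [b|] //; rewrite /layered /= addr0. Qed.

Lemma sum_Zm (m : nat) (M : nmodType) (G : nat -> M) : (1 < m)%N ->
  \sum_(k : 'Z_m) G k = \sum_(0 <= r < m) G r.
Proof. by move=> m1; rewrite -[in RHS](Zp_cast m1) big_mkord. Qed.

Lemma sum_pred (B : finType) (P : pred B) : (\sum_b (P b : nat))%N = #|P|.
Proof.
rewrite -sum1_card [RHS]big_mkcond; apply: eq_bigr => b _.
by rewrite unfold_in; case: (P b).
Qed.

Lemma sum_predC1 (B : finType) (b0 : B) : (\sum_b (b != b0 : nat))%N = #|B|.-1.
Proof. by rewrite sum_pred -(cardC1 b0); apply: eq_card => b; rewrite !inE. Qed.

Lemma sum_pred1 (B : finType) (b0 : B) : (\sum_b (b == b0 : nat))%N = 1%N.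
Proof. by rewrite sum_pred -(card1 b0); apply: eq_card => b; rewrite !inE. Qed.

(** One layer carries the odd recolouring of the plane, each of the others a
    constant one. *)
Lemma decomposes3_of_odd_plane (m : nat) :
  (1 < m)%N -> odd_plane m -> decomposes m (option bool).
Proof.
move=> m1 [E [c [Einj cinj _ Efull]]].
pose ka (p : 'Z_m * ('Z_m * 'Z_m)) := if p.1 == 0 then E p.2 else c p.1.
exists ('Z_m * ('Z_m * 'Z_m))%type, (layered (@plane m)),
  (fun z p => layered (@plane m) (ka p z) p); split.
- exact/toroidal_layered/toroidal_plane.
- by exists ka => // p; rewrite /ka; case: ifP.
- move=> z.
  apply: (@skew_full _ _ _ fst snd (fun p => layered (@plane m) (ka p z) p) _
    (fun (k : 'Z_m) (x : 'Z_m * 'Z_m) => x + step m (ka (k, x) z)) 0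
    ('Z_m * 'Z_m)%type (fun g a => forall x, g x = x + a)
    (fun k : 'Z_m => if k == 0 then 0 else step m (c k z))
    _ _ (full_succ (p := m))).
  + by exists id => [[]|[]].
  + by move=> [s x]; rewrite layered_planeE.
  + by move=> g g' a e Hg x; rewrite -e.
  + by move=> x; rewrite addr0.
  + by move=> g g' a a' Hg Hg' x; rewrite /= Hg' Hg addrA.
  + by [].
  + by move=> k /negbTE kn x; rewrite kn /ka /= kn.
  + move=> F HF; apply: full_eq (Efull z) => x; rewrite /= HF /ka /= ?eqxx; congr (_ + _).
    rewrite (eq_bigr (fun k : 'Z_m => if k == 0%N :> nat then 0 else step m (c k z))) //.
    rewrite (sum_Zm (fun r => if r == 0%N then 0 else step m (c r z)) m1).
    by rewrite [RHS]big_ltn ?(ltnW m1) // eqxx add0r [LHS]big_nat [RHS]big_nat;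
       apply: eq_bigr => r /andP [r1 _]; rewrite gtn_eqF.
Qed.

Lemma coprime_dvdD (s t m : nat) : (m %| s + t)%N -> coprime t m -> coprime s m.
Proof.
move=> d /eqP c; rewrite /coprime -dvdn1 -c dvdn_gcd dvdn_gcdr andbT.
by rewrite -(dvdn_addr _ (dvdn_gcdl s m)) (dvdn_trans (dvdn_gcdr s m)).
Qed.

(** Three layers are recoloured, two of them differently on one column of the
    plane. Every colour is triangular, with totals congruent to [1], [-1], [2] or
    [-2]; these are prime to the odd number [m]. *)
Lemma decomposes3_odd (m : nat) : (3 <= m)%N -> odd m -> decomposes m (option bool).
Proof.
case: m => [|[|[|n]]] // _; set m := n.+3 => odm.
pose ka (p : 'Z_m * ('Z_m * 'Z_m)) (z : option bool) :=
  match p.1 : nat with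
  | 0 => match z with None => Some false | Some false => None | Some true => Some true end
  | 1 => if p.2.1 == 0%R then turn (turn z)
         else match z with None => None | Some b => Some (~~ b) end
  | 2 => if p.2.1 == 0%R then match z with None => Some true | Some true => None | _ => z end
         else z
  | _ => z
  end%N.
pose nn (z : option bool) (k : 'Z_m) : nat * nat :=
  match z, (k : nat) with
  | None, 0 => (1, 0) | None, 1 => (0, 1) | None, 2 => (0, 1) | None, _ => (0, 0)
  | Some false, 0 => (0, 0) | Some false, 1 => (0, n.+2) | Some false, _ => (1, 0)
  | Some true, 0 => (0, m) | Some true, 1 => (1, 0) | Some true, 2 => (0, n.+2)
  | Some true, _ => (0, m)
  end%N.
have kainj p : injective (ka p).
  by case: p => [[[|[|[|k]]] km] x] z z'; rewrite /ka /=; try case: (x.1 == 0);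
     case: z z' => [[]|] [[]|].
exists ('Z_m * ('Z_m * 'Z_m))%type, (layered (@plane m)),
  (fun z p => layered (@plane m) (ka p z) p); split.
- exact/toroidal_layered/toroidal_plane.
- by exists ka.
- move=> z.
  apply: (@skew_tri _ _ _ fst snd (fun s : 'Z_m => s + 1) (fun s : 'Z_m => s + 1) _ _ _
    _ _ fst snd (fun p => layered (@plane m) (ka p z) p) _
    (fun (k : 'Z_m) (x : 'Z_m * 'Z_m) => x + step m (ka (k, x) z)) (nn z)
    _ _ (full_succ (p := m))).
  + by exists id => [[]|[]].
  + exact: full_succ.
  + exact: full_succ.
  + by exists id => [[]|[]].
  + by move=> [s x]; rewrite layered_planeE.
  + have cst (k : nat * nat) i j (g : 'Z_m * 'Z_m -> 'Z_m * 'Z_m) :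
        (forall x, g x = x + (i%:R, j%:R)) -> k = (i, m * j)%N ->
        tri fst snd (fun s : 'Z_m => s + 1) (fun s : 'Z_m => s + 1) g k.
      move=> Hg ->; exists (fun=> j); first by rewrite sum_nat_const card_Zm.
      by move=> x; rewrite !iter_succ Hg.
    have ind (k : nat * nat) i (P : pred 'Z_m) (g : 'Z_m * 'Z_m -> 'Z_m * 'Z_m) :
        (forall x, g x = x + (i%:R, (P x.1 : nat)%:R)) -> k = (i, #|P|)%N ->
        tri fst snd (fun s : 'Z_m => s + 1) (fun s : 'Z_m => s + 1) g k.
      by move=> Hg ->; exists (fun x => P x); [rewrite sum_pred | move=> x; rewrite !iter_succ Hg].
    move=> [k km]; case: z => [[]|]; case: k km => [|[|[|k]]] km; rewrite /nn /ka /=.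
    * by apply: (cst _ 0%N 1%N) => [x|]; rewrite ?muln1.
    * by apply: (cst _ 1%N 0%N) => [x|]; rewrite ?muln0 //; case: ifP.
    * apply: (ind _ 0%N (predC1 0)) => [x|]; last by rewrite cardC1 card_Zm.
      by rewrite /= ; case: (x.1 == 0).
    * by apply: (cst _ 0%N 1%N) => [x|]; rewrite ?muln1.
    * by apply: (cst _ 0%N 0%N) => [x|]; rewrite ?muln0.
    * apply: (ind _ 0%N (predC1 0)) => [x|]; last by rewrite cardC1 card_Zm.
      by rewrite /= ; case: (x.1 == 0).
    * by apply: (cst _ 1%N 0%N) => [x|]; rewrite ?muln0 //; case: ifP.
    * by apply: (cst _ 1%N 0%N) => [x|]; rewrite ?muln0.
    * by apply: (cst _ 1%N 0%N) => [x|]; rewrite ?muln0.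
    * apply: (ind _ 0%N (pred1 0)) => [x|]; last by rewrite card1.
      by rewrite /= ; case: (x.1 == 0).
    * apply: (ind _ 0%N (pred1 0)) => [x|]; last by rewrite card1.
      by rewrite /= ; case: (x.1 == 0).
    * by apply: (cst _ 0%N 0%N) => [x|]; rewrite ?muln0.
  + rewrite card_Zm // !big_ord_recl; case: z => [[]|] /=;
      rewrite sum_nat_const card_ord ?muln0 ?coprime1n // muln1.
    by apply: (coprime_dvdD (t := 2)); rewrite ?coprime2n // !add0n add1n addn2.
  + rewrite card_Zm // !big_ord_recl; case: z => [[]|] /=;
      rewrite sum_nat_const card_ord ?muln0 ?coprime2n //.
      apply: (coprime_dvdD (t := 1)); rewrite ?coprime1n //.
      by rewrite [X in (_ %| X)%N](_ : _ = m * n.+2)%N ?dvdn_mulr //; rewrite /m; nia.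
    by rewrite !add0n !addn0 /m coprimenS.
Qed.

(** * Doubling plus one, for odd moduli *)

Definition swap (T : eqType) (x y z : T) : T :=
  if z == x then y else if z == y then x else z.

Lemma swap_inj (T : eqType) (x y : T) : injective (swap x y).
Proof.
apply: (can_inj (g := swap x y)) => z; rewrite /swap.
have [->|zx] := eqVneq z x; first by rewrite eqxx; case: eqVneq.
by have [->|zy] := eqVneq z y; rewrite ?eqxx // (negbTE zx) (negbTE zy).
Qed.


Section Labels.
Variables (U : finType) (k l : nat).
Hypothesis kl : (k * l <= #|U|)%N.

(** The labels [Some p] are used once each; the rows left over share the label
    [None]. *)
Lemma labelled_rows : exists rk : U -> option ('I_k * 'I_l),
  forall P : pred (option ('I_k * 'I_l)),
    #|[pred b | P (rk b)]| = (#|[pred p | P (Some p)]| + (P None : nat) * (#|U| - k * l))%N.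
Proof.
have cX : #|{: 'I_k * 'I_l}| = (k * l)%N by rewrite card_prod !card_ord.
have le : (#|{: 'I_k * 'I_l}| <= #|U|)%N by rewrite cX.
pose io (p : 'I_k * 'I_l) : U := enum_val (widen_ord le (enum_rank p)).
have io_inj : injective io.
  by move=> p q /enum_val_inj /(congr1 val) /= /val_inj /enum_rank_inj.
exists (fun b => [pick p | io p == b]) => P.
have rk_io p : [pick q | io q == io p] = Some p.
  by case: pickP => [q /eqP /io_inj -> // | /(_ p)]; rewrite eqxx.
rewrite -(cardID (mem (codom io)) [pred b | _]); congr (_ + _)%N.
  rewrite -(card_image io_inj); apply: eq_card => b; rewrite !inE /=.
  apply/idP/idP => [/andP [+ bc] | /imageP [p]].
    by have /codomP [p ->] : b \in codom io := bc; rewrite rk_io => Pp; apply/imageP; exists p.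
  by rewrite inE => Pp ->; rewrite rk_io Pp /= -/(_ \in codom io) codom_f.
have rk_out b : b \notin codom io -> [pick q | io q == b] = None.
  by case: pickP => // q /eqP <-; rewrite codom_f.
case: (boolP (P None)) => PN; last first.
  rewrite mul0n; apply: eq_card0 => b; rewrite !inE; apply/negP => /andP [bc].
  by rewrite rk_out // (negbTE PN).
rewrite mul1n -cX -(card_codom io_inj) -(cardC (mem (codom io))) addKn.
apply: eq_card => b; rewrite !inE; case: (boolP (b \in codom io)) => //= bc.
by rewrite rk_out.
Qed.
End Labels.

Section Act.
Variables (m : nat) (I U : finType) (ga : I -> U -> U).

Definition act (o : option (I + I)) (y : U * U) : U * U :=
  match o with
  | None => y | Some (inl i) => (ga i y.1, y.2) | Some (inr i) => (y.1, ga i y.2)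
  end.

Lemma layered_box o (p : 'Z_m * (U * U)) :
  layered (box ga ga) o p = (p.1 + 1, act o p.2).
Proof. by case: o => [[i|i]|]. Qed.

Definition flip (o : option (I + I)) : option (I + I) :=
  match o with
  | None => None | Some (inl i) => Some (inr i) | Some (inr i) => Some (inl i)
  end.

Lemma flip_inj : injective flip.
Proof. by move=> [[i|i]|] [[j|j]|] //= [] ->. Qed.
End Act.

Section Layers.
Variables (m : nat) (X A B : finType).

Lemma layers_tri (pb : X -> B) (pa : X -> A) (be : B -> B) (al : A -> A)
    (h : 'Z_m -> X -> X) (n : 'Z_m -> nat * nat) :
  bijective (fun x => (pb x, pa x)) -> full be -> full al ->
  (forall s, tri pb pa be al (h s) (n s)) ->
  coprime (\sum_s (n s).1)%N #|B| -> coprime (\sum_s (n s).2)%N #|A| ->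
  full (fun p : 'Z_m * X => (p.1 + 1, h p.1 p.2)).
Proof.
move=> bij Hbe Hal Hh c1 c2.
apply: (@skew_tri _ _ _ pb pa be al bij Hbe Hal _ _ fst snd _ _ h n _ _
  (full_succ (p := m)) Hh c1 c2) => //.
by exists id => [[]|[]].
Qed.

(** Outside the layer [k0], one turn amounts to a single step in each row, along
    a cycle depending on the row; together with the change of rows at the column
    [a0] this is the situation of [sweep_full]. *)
Lemma layers_sweep (ga : B -> A -> A) (be : B -> B) (a0 : A) (k0 : 'Z_m)
    (aa : 'Z_m -> {ffun B -> nat}) (h : 'Z_m -> A * B -> A * B) :
  (forall b, full (ga b)) -> full be -> aa k0 = 0 ->
  (forall b, (\sum_s aa s) b = 1%N) ->
  (forall s, s != k0 -> forall y, h s y = (iter (aa s y.2) (ga y.2) y.1, y.2)) ->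
  (forall y, h k0 y = if y.1 == a0 then (y.1, be y.2) else y) ->
  full (fun p : 'Z_m * (A * B) => (p.1 + 1, h p.1 p.2)).
Proof.
move=> Hga Hbe aa0 sE Hh Hk.
apply: (@skew_full _ _ _ fst snd _ _ h k0 {ffun B -> nat}
  (fun g N => forall y, g y = (iter (N y.2) (ga y.2) y.1, y.2)) aa
  _ _ (full_succ (p := m))) => //.
- by exists id => [[]|[]].
- by move=> g g' N e Hg y; rewrite -e.
- by move=> [a b]; rewrite ffunE.
- by move=> g g' N N' Hg Hg' y; rewrite /= Hg' Hg /= ffunE addrC iterD.
- move=> F HF; apply: full_eq (sweep_full (ga := ga) a0 Hga Hbe) => [[a b]].
  by rewrite /= Hk /=; case: eqP => [->|_] /=; rewrite HF /= sE.
Qed.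
End Layers.

(** There is no such labelling for even [m]: the classes would all have an odd
    number of rows, and there are [2 k + 3] of them, while the total number of
    rows is even. *)
Lemma odd_labels (m k : nat) (U : finType) :
  (3 <= m)%N -> odd m -> (k.+1 * m <= #|U|)%N -> (m %| #|U|)%N ->
  exists ty : U -> bool * 'I_k.+2,
    [/\ forall b, ty b != (true, ord0),
        forall i, coprime #|[pred b | ty b == (false, i)]| m
      & forall i, i != ord0 -> coprime #|[pred b | ty b == (true, i)]| m].
Proof.
case: m => [|[|[|n]]] // _; set m := n.+3 => odm le dv.
have [rk cnt] := labelled_rows le.
pose g (o : option ('I_k.+1 * 'I_m)) : bool * 'I_k.+2 :=
  match o with
  | None => (false, lift ord0 ord0)
  | Some (q, s) =>
    if s == ord0 then (false, lift ord0 q)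
    else if (q == ord0) && (s == lift ord0 ord0) then (false, ord0) else (true, lift ord0 q)
  end.
exists (fun b => g (rk b)); split.
- move=> b; case: (rk b) => [[q s]|] //=.
  by case: ifP => // _; case: ifP => // _; rewrite xpair_eqE.
- move=> i; rewrite (cnt (fun o => g o == (false, i))) {cnt}.
  have rest : (m %| #|U| - k.+1 * m)%N by rewrite dvdn_sub // dvdn_mull.
  have [->|[q ->]] : i = ord0 \/ exists q, i = lift ord0 q.
    by case: (unliftP ord0 i) => [q ->|->]; [right; exists q | left].
    rewrite (eq_card (B := pred1 (ord0, lift ord0 ord0))) => [|[q s]].
      by rewrite card1 /= addn0 coprime1n.
    rewrite !inE /=; case: (eqVneq s ord0) => [->|s0]; first last.
      by case: ifP => [/andP [/eqP -> /eqP ->]|]; rewrite !xpair_eqE ?eqxx // => ->.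
    by rewrite !xpair_eqE [lift _ _ == _]eq_sym !(negbTE (neq_lift _ _)) !andbF.
  rewrite (eq_card (B := pred1 (q, ord0))) => [|[q' s]].
    rewrite card1; apply: (@coprime_dvdD _ m.-1); last by rewrite coprime_sym coprimenP.
    by rewrite addnAC dvdn_add // ?dvdn_mull // /m dvdnn.
  rewrite !inE /=; case: (eqVneq s ord0) => [->|s0].
    by rewrite !xpair_eqE /= andbT; apply/eqP/eqP => [/lift_inj|->].
  by case: ifP => [/andP [/eqP -> /eqP ->]|]; rewrite !xpair_eqE ?(negbTE s0) ?andbF.
- move=> i i0; rewrite (cnt (fun o => g o == (true, i))) {cnt} addn0.
  case: (unliftP ord0 i) i0 => [q ->|-> //] _.
  have [q0|q0] := eqVneq q ord0.
    rewrite (eq_card (B := predX (pred1 ord0) (predC (pred2 ord0 (lift ord0 ord0))))); last first.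
      move=> [q' s]; rewrite !inE /= q0.
      case: (eqVneq s ord0) => [->|s0]; first by rewrite !xpair_eqE andbF.
      case: (eqVneq s (lift ord0 ord0)) => [_|s1]; rewrite ?andbF /= ?andbT.
        case: ifP => [//|/negbT n0]; rewrite !xpair_eqE /=; apply/negP => /eqP /lift_inj e.
        by rewrite e eqxx in n0.
      by rewrite !xpair_eqE /=; apply/eqP/eqP => [/lift_inj|->].
    rewrite cardX card1 mul1n.
    have := cardC (pred2 (ord0 : 'I_m) (lift ord0 ord0)).
    rewrite card2 card_ord /= => e; apply: (@coprime_dvdD _ 2); last by rewrite coprime2n.
    by rewrite addnC e.
  rewrite (eq_card (B := predX (pred1 q) (predC1 ord0))) => [|[q' s]].
    by rewrite cardX card1 mul1n cardC1 card_ord coprimenS.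
  rewrite !inE /=; case: (eqVneq s ord0) => [_|s0]; first by rewrite !xpair_eqE andbF.
  rewrite andbT; case: ifP => [/andP [/eqP -> _]|_].
    by rewrite xpair_eqE /= eq_sym (negbTE q0).
  by rewrite !xpair_eqE /=; apply/eqP/eqP => [/lift_inj|->].
Qed.

(** The torus is the product of two copies of the given one, with colours [e i]
    and [f i], and of the extra direction [None]. The rows are indexed by the
    second copy. In a row of type [(false, i)] the extra direction changes places
    with [e i] in layer [0], in a row of type [(true, i)] in layer [1], where
    [e i] and [f i] are exchanged beforehand for all [i]. Thus each of these
    colours loses one step in the rows of one type, which makes its total prime
    to [m], while the extra direction gains one step in each row. To change rows,
    it borrows the direction [f ord0] at one column of layer [2]. *)
Lemma decomposes_odd_step (m k : nat) : (3 <= m)%N -> odd m ->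
  decomposes m 'I_k.+2 -> decomposes m (option ('I_k.+2 + 'I_k.+2)).
Proof.
case: m => [|[|[|n]]] // m3 odm; have m1 : (1 < n.+3)%N by [].
move=> [U [de [ga [tor rec Hga]]]].
have cU : #|U| = (n.+3 ^ k.+2)%N by rewrite (toroidal_card m1 tor) card_ord.
have coU s : coprime s n.+3 -> coprime s #|U| by rewrite cU; apply: coprimeXr.
have dvU : (n.+3 %| #|U|)%N by rewrite cU dvdn_exp.
have leU : (k.+1 * n.+3 <= #|U|)%N.
  rewrite cU expnS mulnC leq_mul2l /=; elim: (k) => [|j IH]; first by rewrite expn1.
  by rewrite expnS; nia.
have [ty [ty0 tyf tyt]] := odd_labels m3 odm leU dvU.
have [a0 _] : exists a0 : U, a0 \in U by apply/card_gt0P; rewrite cU expn_gt0.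
pose e i : option ('I_k.+2 + 'I_k.+2) := Some (inl i).
pose f i : option ('I_k.+2 + 'I_k.+2) := Some (inr i).
pose row t (b : U) := if (ty b).1 == t then swap None (e (ty b).2) else id.
pose ka (p : 'Z_n.+3 * (U * U)) (z : option ('I_k.+2 + 'I_k.+2)) :=
  match p.1 : nat with
  | 0 => row false p.2.2 z
  | 1 => row true p.2.2 (flip z)
  | 2 => if p.2.1 == a0 then swap None (f ord0) z else z
  | _ => z
  end%N.
have rowinj t b : injective (row t b).
  by rewrite /row; case: ifP => _; [exact: swap_inj | move=> ? ?].
exists ('Z_n.+3 * (U * U))%type, (layered (box de de)),
  (fun z p => layered (box ga ga) (ka p z) p); split.
- exact/toroidal_layered/toroidal_box.
- apply: recoloring_trans (recoloring_layered _ (recoloring_box rec rec)) _.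
  exists ka => // [[[[|[|[|s]]] sm] y]] z z'; rewrite /ka /= => //.
  + exact: rowinj.
  + by move=> /rowinj /flip_inj.
  + by case: ifP => _ //; apply: swap_inj.
have bijYf : bijective (fun y : U * U => (y.1, y.2)) by exists id => [[]|[]].
have bijYs : bijective (fun y : U * U => (y.2, y.1)).
  by exists (fun y => (y.2, y.1)) => [[]|[]].
have rowE t b i : row t b (e i) = if ty b == (t, i) then None else e i.
  rewrite /row; case: (ty b) => t' j; rewrite xpair_eqE /=; case: eqP => //= _.
  rewrite /swap /= /e eq_sym; 
  have -> : (Some (inl j) == Some (inl i) :> option ('I_k.+2 + 'I_k.+2)) = (j == i) by [].
  by case: (eqVneq j i).
have rowF t b i : row t b (f i) = f i by rewrite /row; case: ifP.
have row0 t b : row t b None = if (ty b).1 == t then e (ty b).2 else None.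
  by rewrite /row; case: ifP.
pose h z (s : 'Z_n.+3) (y : U * U) := act ga (ka (s, y) z) y.
(* each colour is a skew product over the layers *)
have tri_case z (pb : U * U -> U) (pa : U * U -> U) i nn :
    bijective (fun y => (pb y, pa y)) ->
    (forall s, tri pb pa (ga i) (ga i) (h z s) (nn s)) ->
    coprime (\sum_s (nn s).1)%N n.+3 -> coprime (\sum_s (nn s).2)%N n.+3 ->
    full (fun p => layered (box ga ga) (ka p z) p).
  move=> bij Hh c1 c2.
  have := layers_tri bij (Hga i) (Hga i) Hh (coU _ c1) (coU _ c2).
  by apply: full_eq => [[s y]]; rewrite layered_box.
move=> [[i|i]|].
- pose nn (s : 'Z_n.+3) : nat * nat :=
    match s : nat with
    | 0 => (0, #|[predC [pred b | ty b == (false, i)]]|)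
    | 1 => (1, 0)
    | _ => (0, #|U|)
    end%N.
  apply: (tri_case (e i) snd fst i nn) => //.
  + move=> [[|[|s]] sm]; rewrite /nn /h /ka /=.
    * exists (fun b => (ty b != (false, i) : nat)).
        by rewrite sum_pred; apply: eq_card => b; rewrite !inE.
      by move=> [a b] /=; rewrite rowE; case: eqP.
    * by exists (fun=> 0%N); [rewrite sum_nat_const muln0 | move=> y; rewrite rowF].
    * exists (fun=> 1%N); first by rewrite sum_nat_const muln1.
      by move=> y; case: s sm => [|s] sm //=; case: ifP.
  + by rewrite !big_ord_recl /= sum_nat_const muln0 coprime1n.
  + rewrite !big_ord_recl /= sum_nat_const card_ord.
    apply: (@coprime_dvdD _ #|[pred b | ty b == (false, i)]|); last exact: tyf.
    have := cardC [pred b | ty b == (false, i)].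
    set x := #|[pred b | _]|; set y := #|[predC _]| => cC.
    rewrite [X in (_ %| X)%N](_ : _ = n.+2 * #|U|)%N; first by rewrite dvdn_mull.
    by rewrite -cC; ring.
- have [->|i0] := eqVneq i ord0.
    pose nn (s : 'Z_n.+3) : nat * nat :=
      match s : nat with
      | 1 => (1, 0)
      | 2 => (0, #|U|.-1)
      | _ => (0, #|U|)
      end%N.
    apply: (tri_case (f ord0) fst snd ord0 nn) => //.
    + move=> [[|[|[|s]]] sm]; rewrite /nn /h /ka /=.
      * by exists (fun=> 1%N); [rewrite sum_nat_const muln1 | move=> y; rewrite rowF].
      * exists (fun=> 0%N); first by rewrite sum_nat_const muln0.
        by move=> y; rewrite rowE (negbTE (ty0 _)).
      * exists (fun a => (a != a0 : nat)); first exact: sum_predC1.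
        by move=> [a b] /=; case: eqVneq.
      * by exists (fun=> 1%N); rewrite ?sum_nat_const ?muln1.
    + by rewrite !big_ord_recl /= sum_nat_const muln0 coprime1n.
    + rewrite !big_ord_recl /= sum_nat_const card_ord.
      apply: (@coprime_dvdD _ 1); last by rewrite coprime1n.
      rewrite [X in (_ %| X)%N](_ : _ = n.+2 * #|U|)%N; first by rewrite dvdn_mull.
      have : (0 < #|U|)%N by rewrite cU expn_gt0.
      by case: #|U| => // u _ /=; ring.
  pose nn (s : 'Z_n.+3) : nat * nat :=
    match s : nat with
    | 1 => (0, #|[predC [pred b | ty b == (true, i)]]|)
    | _ => (1, 0)
    end%N.
  apply: (tri_case (f i) snd fst i nn) => //.
  + move=> [[|[|[|s]]] sm]; rewrite /nn /h /ka /=.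
    * by exists (fun=> 0%N); [rewrite sum_nat_const muln0 | move=> y; rewrite rowF].
    * exists (fun b => (ty b != (true, i) : nat)).
        by rewrite sum_pred; apply: eq_card => b; rewrite !inE.
      by move=> [a b] /=; rewrite rowE; case: eqP.
    * exists (fun=> 0%N); first by rewrite sum_nat_const muln0.
      move=> [a b] /=; case: (a == a0) => //=; rewrite /swap /=.
      have -> : (f i == f ord0) = (i == ord0) by [].
      by rewrite (negbTE i0).
    * by exists (fun=> 0%N); rewrite ?sum_nat_const ?muln0.
  + by rewrite !big_ord_recl /= sum_nat_const card_ord muln1 !add1n coprimenS.
  + rewrite !big_ord_recl /= sum_nat_const muln0.
    apply: (@coprime_dvdD _ #|[pred b | ty b == (true, i)]|); last exact: tyt.
    have := cardC [pred b | ty b == (true, i)].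
    set x := #|[pred b | _]|; set y := #|[predC _]| => cC.
    rewrite [X in (_ %| X)%N](_ : _ = #|U|)%N //.
    by rewrite -cC; ring.
- pose aa (s : 'Z_n.+3) : {ffun U -> nat} :=
    match s : nat with
    | 0 => [ffun b => ((ty b).1 == false : nat)]
    | 1 => [ffun b => ((ty b).1 == true : nat)]
    | _ => [ffun=> 0]
    end%N.
  pose k0 : 'Z_n.+3 := @Ordinal n.+3 2 isT.
  apply: full_eq (layers_sweep (ga := fun b => ga (ty b).2) (be := ga ord0) (a0 := a0)
    (k0 := k0) (aa := aa) (h := h None) _ _ _ _ _ _) => //.
  + by move=> b; rewrite !big_ord_recl big1 //= !ffunE; case: (ty b).1.
  + move=> [[|[|[|s]]] sm] // _ [a b]; rewrite /aa /h /ka /= ?ffunE //=.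
    * by rewrite row0; case: eqP.
    * by rewrite row0; case: eqP.
  + by move=> [a b]; rewrite /h /ka /=; case: eqP.
Qed.

(** * Doubling plus three, for even moduli *)

(** A labelling in the spirit of [odd_labels] that gives up the direction
    [ord0], whose rows are all or none. The subset [sh] contains exactly one row
    of each type [(false, i)] and [m - 1] rows of each type [(true, i)]: these
    numbers are prime to [m], and their sum vanishes modulo [m]. *)
Lemma even_labels (m k : nat) (U : finType) :
  (2 <= m)%N -> (k * m <= #|U|)%N -> (m %| #|U|)%N ->
  exists (ty : U -> bool * 'I_k.+1) (sh : pred U),
    [/\ (forall b, ty b == (false, ord0)) \/ (forall b, (ty b).2 != ord0),
        forall b, sh b -> (ty b).2 != ord0,
        (m %| #|sh|)%N,
        forall b, ty b != (true, ord0)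
      & forall i, i != ord0 ->
        [/\ #|[pred b | sh b && (ty b == (false, i))]| = 1%N,
            #|[pred b | sh b && (ty b == (true, i))]| = m.-1
          & forall t, coprime #|[pred b | ty b == (t, i)]| m]].
Proof.
move=> m2 le dv; have [rk cnt] := labelled_rows le.
case: m m2 le dv rk cnt => [|m] // m2 le dv rk cnt.
pose g (o : option ('I_k * 'I_m.+1)) : bool * 'I_k.+1 :=
  match o with
  | None => (false, inord 1)
  | Some (q, s) => (s != ord0, lift ord0 q)
  end.
have rest : (m.+1 %| #|U| - k * m.+1)%N by rewrite dvdn_sub // dvdn_mull.
have cF q : #|[pred p | g (Some p) == (false, lift ord0 q)]| = 1%N.
  rewrite -(card1 (q, ord0 : 'I_m.+1)); apply: eq_card => [[q' s]]; rewrite !inE /=.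
  by rewrite !xpair_eqE (inj_eq (@lift_inj _ ord0)) andbC; case: (s == ord0).
have cT q : #|[pred p | g (Some p) == (true, lift ord0 q)]| = m.
  rewrite (eq_card (B := predX (pred1 q) (predC1 ord0))) => [|[q' s]].
    by rewrite cardX card1 mul1n cardC1 card_ord.
  by rewrite !inE /= xpair_eqE (inj_eq (@lift_inj _ ord0)) andbC; case: (s == ord0).
exists (fun b => g (rk b)), (fun b => rk b : bool); split.
- have [k0|k0] := posnP k; [left | right] => b; case: (rk b) => [[q s]|] //=.
  + by have := ltn_ord q; rewrite [X in (_ < X)%N]k0.
  + by apply/eqP; congr pair; apply: val_inj; rewrite /= val_insubd k0.
  + by rewrite -val_eqE /= val_insubd ltnS k0.
- by move=> b; case: (rk b) => [[q s]|].
- rewrite (eq_card (B := [pred b | (fun o : option ('I_k * 'I_m.+1) => o : bool) (rk b)])) //.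
  rewrite cnt /= addn0 (eq_card (B := predT)) // cardT -cardE card_prod !card_ord.
  exact: dvdn_mull.
- by move=> b; case: (rk b) => [[q s]|]; rewrite [g _]/= xpair_eqE ?andbF.
- move=> i i0; case: (unliftP ord0 i) i0 => [q ->|->] // _.
  split.
  + rewrite -[RHS](cF q) -[RHS]addn0.
    by rewrite -(cnt (fun o => (o : bool) && (g o == (false, lift ord0 q)))).
  + rewrite -[RHS](cT q) -[RHS]addn0.
    by rewrite -(cnt (fun o => (o : bool) && (g o == (true, lift ord0 q)))).
  + move=> t; rewrite (cnt (fun o => g o == (t, lift ord0 q))).
    case: t; first by rewrite cT addn0 coprimenS.
    rewrite cF; apply: (@coprime_dvdD _ m); last exact: coprimenS.
    by rewrite addnAC dvdn_add // ?add1n ?dvdnn // dvdn_mull.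
Qed.
Lemma sum_section (R : Type) (idx : R) (op : Monoid.com_law idx) (S A B : finType)
    (sp : B -> S) (a0 : A) (G : B -> R) :
  \big[op/idx]_(k : S * (A * B))
    (if (k.1 == sp k.2.2) && (k.2.1 == a0) then G k.2.2 else idx) = \big[op/idx]_b G b.
Proof.
rewrite -big_mkcond /= (reindex (fun b => (sp b, (a0, b)))) /=.
  by apply: eq_bigl => b; rewrite !eqxx.
exists (fun k => k.2.2) => // [[s [a b]]]; rewrite inE /= => /andP [/eqP -> /eqP ->] //.
Qed.

Definition plane_part (I : Type) (o : option (bool + I)) : option bool :=
  if o is Some (inl b) then Some b else None.

Definition torus_part (I : Type) (o : option (bool + I)) : option I :=
  if o is Some (inr i) then Some i else None.

Lemma plane_part_inl (I : Type) o : plane_part (omap (@inl bool I) o) = o.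
Proof. by case: o. Qed.

Lemma torus_part_inl (I : Type) o : torus_part (omap (@inl bool I) o) = None.
Proof. by case: o. Qed.

Definition on_plane (I : Type) (g : option bool -> option bool) (o : option (bool + I)) :
    option (bool + I) :=
  match o with
  | None => omap inl (g None) | Some (inl b) => omap inl (g (Some b)) | Some (inr _) => o
  end.

Lemma on_plane_inj (I : Type) g : injective g -> injective (@on_plane I g).
Proof.
have om_inj : injective (omap (@inl bool I)) by move=> [b|] [b'|] // [] ->.
have nr o i : omap (@inl bool I) o <> Some (inr i) by case: o.
move=> gi [[b|i]|] [[b'|i']|] //=.
- by move=> /om_inj/gi [->].
- by move=> /nr.
- by move=> /om_inj/gi.
- by move=> /esym/nr.
- by move=> /esym/nr.
- by move=> /om_inj/gi.
- by move=> /nr.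
Qed.

Definition swap_if (b : bool) (T : eqType) (x y z : T) : T := if b then swap x y z else z.

Lemma swap_if_inj b (T : eqType) (x y : T) : injective (swap_if b x y).
Proof. by rewrite /swap_if; case: b; [exact: swap_inj | move=> ? ?]. Qed.

(** The colours are named after the extra direction [None], the two directions
    [gg] of the plane, and the directions [ee] and [ff] of the two copies of the
    given torus. The first three take the plane as a fibre, over the
    layers and the two copies. They feel the recolourings [E] and [c] at the
    points of [in_context], and they need a single cycle in the base:
    for [None] it is the one of the odd case, and for [gg] it comes from
    [turn_in], where [gg] is exchanged with [ee ord0] and [ff ord0], in one order
    or the other according to a diagonal. The colours [ee ord0] and [ff ord0] get
    in return a move in the plane, hence a single cycle over the layers and the
    plane, and they take the two copies as a fibre. The colours [ee i] and [ff i] with [i] not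
    [ord0] have their single cycle over the layers and the two copies as in the
    odd case; they still have to move in the plane, and this is the purpose of
    [short_swap]: at two columns of the rows in [sh], the step lost in a row of
    type [(t, i)] becomes a step in the plane. *)
Section EvenStep.
Variables (n k : nat) (U : finType) (ga : 'I_k.+1 -> U -> U).
Local Notation m := n.+4.
Local Notation V := ('Z_m * 'Z_m)%type.
Local Notation J := (option (bool + ('I_k.+1 + 'I_k.+1))).
Local Notation base := ('Z_m * (U * U))%type.

Variables (E : V -> option bool -> option bool) (c : nat -> option bool -> option bool).
Variables (ty : U -> bool * 'I_k.+1) (sh : pred U) (phi : U -> 'Z_#|U|) (x1 x2 : U).

Definition gg b : J := Some (inl b).
Definition ee i : J := Some (inr (inl i)).
Definition ff i : J := Some (inr (inr i)).

(** The exchange with [gg true] is restricted to one line of the plane in order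
    that the plane map of [ee i] is triangular with both totals prime to [m]. *)
Definition short_swap (v : V) (a b : U) (z : J) : J :=
  swap_if [&& sh b, a == x2 & v.1 == 0] None (gg true)
    (swap_if (sh b && (a == x1)) None (gg false) z).

Definition row_swap (t : bool) (v : V) (a b : U) (z : J) : J :=
  if (ty b).1 == t then short_swap v a b (swap None (ee (ty b).2) z) else z.

Definition exchange (z : J) : J :=
  match z with
  | Some (inr (inl i)) => if i == ord0 then z else ff i
  | Some (inr (inr i)) => if i == ord0 then z else ee i
  | _ => z
  end.

Definition turn_in (v : V) (a b : U) (z : J) : J :=
  swap_if (v.1 + v.2 == 0) (gg false) (gg true)
    (swap_if (phi a + phi b == 0) (ee ord0) (ff ord0)
      (swap (gg false) (ee ord0) (swap (gg true) (ff ord0) z))).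

Definition context (v : V) (b : U) (o : option bool) : option bool :=
  if enum_rank b == 0%N :> nat then E v o else c (enum_rank b) o.

(** Exchanging [ee ord0] and [ff ord0] over one point of the plane, and
    [ff ord0] with the extra direction at one column, changes the totals of these
    two colours, which would otherwise all vanish modulo [m].
    The column [x1] is kept apart from the column [x2] of the contexts. *)
Definition mix (v : V) (a b : U) (z : J) : J :=
  on_plane (if (a == x2) && (enum_rank b < m)%N then context v b else id)
    (swap_if (a == x1) None (ff ord0) (swap_if (v == 0) (ee ord0) (ff ord0) z)).

Definition even_step (p : 'Z_m * (V * (U * U))) (z : J) : J :=
  let: (v, (a, b)) := p.2 in
  match p.1 : nat with
  | 0 => turn_in v a b z
  | 1 => row_swap false v a b z
  | 2 => mix v a b z
  | 3 => row_swap true v a b (exchange z)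
  | _ => z
  end%N.

Lemma layered_plane_box o (s : 'Z_m) (v : V) (y : U * U) :
  layered (box (@plane m) (box ga ga)) o (s, (v, y)) =
  (s + 1, (v + step m (plane_part o), act ga (torus_part o) y)).
Proof. by case: o => [[b|[i|i]]|]; rewrite /layered /= ?addr0; case: y. Qed.

Hypotheses (Hga : forall i, full (ga i)) (cU : #|U| = (m ^ k.+1)%N).
Hypotheses (x12 : x1 != x2) (phiP : bijective phi)
  (phiS : forall a, phi (ga ord0 a) = phi a + 1).
Hypotheses (Einj : forall x, injective (E x)) (cinj : forall r, injective (c r))
  (c_gg : forall r, c r (Some true) != Some false)
  (Efull : forall z, full (fun x => x + step m (E x z) + \sum_(1 <= r < m) step m (c r z))).
Hypotheses
  (ty0 : (forall b, ty b == (false, ord0)) \/ (forall b, (ty b).2 != ord0))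
  (sh0 : forall b, sh b -> (ty b).2 != ord0)
  (shm : (m %| #|sh|)%N)
  (tyt0 : forall b, ty b != (true, ord0))
  (tyP : forall i, i != ord0 ->
        [/\ #|[pred b | sh b && (ty b == (false, i))]| = 1%N,
            #|[pred b | sh b && (ty b == (true, i))]| = m.-1
          & forall t, coprime #|[pred b | ty b == (t, i)]| m]).

Lemma even_step_inj p : injective (even_step p).
Proof.
have sinj (t : bool) v a b : injective (row_swap t v a b).
  by move=> z z'; rewrite /row_swap /short_swap; case: ifP => _ // e;
    exact: (swap_inj (swap_if_inj (swap_if_inj e))).
case: p => [[[|[|[|[|s]]]] sm] [v [a b]]] z z' //=.
- by rewrite /turn_in => e; exact: (swap_inj (swap_inj (swap_if_inj (swap_if_inj e)))).
- exact: sinj.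
- rewrite /mix => /on_plane_inj H; apply: (swap_if_inj (swap_if_inj (H _))).
  case: ifP => _ o o' //; rewrite /context; case: ifP => _; [exact: Einj | exact: cinj].
- move=> /sinj; case: z z' => [[z|[i|i]]|] [[z'|[j|j]]|] //=;
    try case: ifP => i0; try case: ifP => j0; move=> // [] e; rewrite ?e //;
    by [rewrite -e i0 in j0 | rewrite e j0 in i0].
Qed.

Local Notation layer i := (@Ordinal n.+4 i isT : 'Z_m).

Lemma short_swap_None v a b : short_swap v a b None =
  if sh b then if a == x1 then gg false else if (a == x2) && (v.1 == 0) then gg true else None
  else None.
Proof.
rewrite /short_swap /swap_if; case: (sh b) => //=.
by have [->|_] := eqVneq a x1; rewrite ?(negbTE x12) //=; case: ifP.
Qed.

Lemma short_swap_gg v a b g : short_swap v a b (gg g) =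
  if sh b && (if g then (a == x2) && (v.1 == 0) else a == x1) then None else gg g.
Proof.
rewrite /short_swap /swap_if; case: (sh b) => //=.
by case: g; have [->|_] := eqVneq a x1; rewrite ?(negbTE x12) //=; case: ifP.
Qed.

Lemma eq_ee i j : (ee i == ee j) = (i == j). Proof. by []. Qed.

Lemma eq_ff i j : (ff i == ff j) = (i == j). Proof. by []. Qed.

Lemma row_swap_None t v a b :
  row_swap t v a b None = if (ty b).1 == t then ee (ty b).2 else None.
Proof.
by rewrite /row_swap; case: eqP => // _; rewrite /short_swap /swap_if; do 2! case: ifP.
Qed.

Lemma row_swap_ee t v a b i :
  row_swap t v a b (ee i) = if ty b == (t, i) then short_swap v a b None else ee i.
Proof.
rewrite /row_swap; case: (ty b) => t' j; rewrite xpair_eqE /=; case: eqP => //= _.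
rewrite /swap /= eq_ee eq_sym; case: eqP => // _.
by rewrite /short_swap /swap_if; case: (sh b); case: (a == x1); case: (a == x2); case: (v.1 == 0).
Qed.

Lemma row_swap_ff t v a b i : row_swap t v a b (ff i) = ff i.
Proof. by rewrite /row_swap /short_swap /swap_if; case: eqP => // _; case: (sh b); case: (a == x1);
  case: (a == x2); case: (v.1 == 0). Qed.

Lemma row_swap_gg t v a b g : row_swap t v a b (gg g) =
  if ((ty b).1 == t) && sh b && (if g then (a == x2) && (v.1 == 0) else a == x1)
  then None else gg g.
Proof. by rewrite /row_swap; case: eqP => //= _; rewrite -short_swap_gg; case: g. Qed.

Lemma turn_in_gg v a b g : turn_in v a b (gg g) =
  if (phi a + phi b == 0) (+) g then ff ord0 else ee ord0.
Proof.
by case: g; rewrite /turn_in /swap_if; case: (v.1 + v.2 == 0); case: (phi a + phi b == 0).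
Qed.

Lemma turn_in_None v a b : turn_in v a b None = None.
Proof. by rewrite /turn_in /swap_if; case: (v.1 + v.2 == 0); case: (phi a + phi b == 0). Qed.

Lemma turn_in_ee0 v a b : turn_in v a b (ee ord0) = gg (v.1 + v.2 == 0).
Proof. by rewrite /turn_in /swap_if; case: (v.1 + v.2 == 0); case: (phi a + phi b == 0). Qed.

Lemma turn_in_ff0 v a b : turn_in v a b (ff ord0) = gg (v.1 + v.2 != 0).
Proof. by rewrite /turn_in /swap_if; case: (v.1 + v.2 == 0); case: (phi a + phi b == 0). Qed.

Lemma turn_in_ee v a b i : i != ord0 -> turn_in v a b (ee i) = ee i.
Proof.
move=> /negbTE i0; rewrite /turn_in /swap_if.
by case: (v.1 + v.2 == 0); case: (phi a + phi b == 0); rewrite /swap /= ?eq_ee ?i0 /= ?eq_ee ?i0.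
Qed.

Lemma turn_in_ff v a b i : i != ord0 -> turn_in v a b (ff i) = ff i.
Proof.
move=> /negbTE i0; rewrite /turn_in /swap_if.
by case: (v.1 + v.2 == 0); case: (phi a + phi b == 0); rewrite /swap /= ?eq_ff ?i0 /= ?eq_ff ?i0.
Qed.

Definition in_context (a b : U) := (a == x2) && (enum_rank b < m)%N.

Lemma in_context_x1 b : in_context x1 b = false.
Proof. by rewrite /in_context (negbTE x12). Qed.

Lemma mix_None v a b : mix v a b None =
  if a == x1 then ff ord0
  else if in_context a b then omap inl (context v b None) else None.
Proof.
rewrite /mix -/(in_context a b) /swap_if.
have [->|_] := eqVneq a x1; first by rewrite in_context_x1; case: (v == 0).
by case: (v == 0); case: (in_context a b).
Qed.

Lemma mix_gg v a b g : mix v a b (gg g) =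
  if in_context a b then omap inl (context v b (Some g)) else gg g.
Proof.
rewrite /mix -/(in_context a b) /swap_if.
by case: (a == x1); case: (v == 0); case: (in_context a b); case: g.
Qed.

Lemma mix_ee0 v a b : mix v a b (ee ord0) =
  if v == 0 then if a == x1 then None else ff ord0 else ee ord0.
Proof.
rewrite /mix -/(in_context a b) /swap_if.
have [->|_] := eqVneq a x1; first by rewrite in_context_x1; case: (v == 0).
by case: (v == 0); case: (in_context a b).
Qed.

Lemma mix_ff0 v a b : mix v a b (ff ord0) =
  if v == 0 then ee ord0 else if a == x1 then None else ff ord0.
Proof.
rewrite /mix -/(in_context a b) /swap_if.
have [->|_] := eqVneq a x1; first by rewrite in_context_x1; case: (v == 0).
by case: (v == 0); case: (in_context a b).
Qed.

Lemma mix_ee v a b i : i != ord0 -> mix v a b (ee i) = ee i.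
Proof.
move=> /negbTE i0; rewrite /mix /swap_if.
by case: (v == 0); case: (a == x1); rewrite /swap /= ?eq_ee ?i0 /= ?eq_ee ?i0 //;
  case: ifP.
Qed.

Lemma mix_ff v a b i : i != ord0 -> mix v a b (ff i) = ff i.
Proof.
move=> /negbTE i0; rewrite /mix /swap_if.
by case: (v == 0); case: (a == x1); rewrite /swap /= ?eq_ff ?i0 /= ?eq_ff ?i0 //;
  case: ifP.
Qed.

Definition move_all (z : J) (p : 'Z_m * (V * (U * U))) : 'Z_m * (V * (U * U)) :=
  layered (box (@plane m) (box ga ga)) (even_step p z) p.

Lemma plane_fibre z (h : 'Z_m -> U * U -> U * U) :
  (forall s v y, act ga (torus_part (even_step (s, (v, y)) z)) y = h s y) ->
  full (fun p : base => (p.1 + 1, h p.1 p.2)) ->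
  forall (k0 : base) (M : nmodType) (C : (V -> V) -> M -> Prop) (a : base -> M),
  let hv (p : base) v := v + step m (plane_part (even_step (p.1, (v, p.2)) z)) in
  (forall g g' n, g =1 g' -> C g n -> C g' n) -> C id 0 ->
  (forall g g' n n', C g n -> C g' n' -> C (g' \o g) (n + n')) ->
  a k0 = 0 -> (forall p, p != k0 -> C (hv p) (a p)) ->
  (forall F, C F (\sum_p a p) -> full (F \o hv k0)) ->
  full (move_all z).
Proof.
move=> Hh Hfull k0 M C a hv Cext C1 Cm a0 Ca CF.
apply: (@skew_full _ _ _ (fun p => (p.1, p.2.2)) (fun p => p.2.1) (move_all z) _ hv k0 M C a
  _ _ Hfull Cext C1 Cm a0 Ca CF).
  by exists (fun q => (q.1.1, (q.2, q.1.2))) => [[s [v y]]|[[s y] v]].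
by move=> [s [v y]]; rewrite /move_all layered_plane_box /= Hh.
Qed.

Lemma m_dvd_U : (m %| #|U|)%N. Proof. by rewrite cU dvdn_exp. Qed.

Lemma coprime_U s : coprime s m -> coprime s #|U|.
Proof. by rewrite cU; apply: coprimeXr. Qed.

Lemma mulrn_dvd (M : zmodType) (x : M) (l q : nat) : x *+ l = 0 -> (l %| q)%N -> x *+ q = 0.
Proof. by move=> x0 /dvdnP [r ->]; rewrite mulnC mulrnA x0 mul0rn. Qed.

Definition busy (b : U) : 'Z_m := if (ty b).1 then layer 3 else layer 1.

(** Over a whole turn the regular steps and the exchanges cancel, and a direction
    of the plane only feels the contexts. *)
Lemma context_sum (M : zmodType) (x y : M) (a1 : U) (w : nat -> M) :
  x *+ m = 0 -> y *+ m = 0 ->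
  \sum_(p : base) ((if p.1 == 0 then 0 else x)
     + (if (p.1 == busy p.2.2) && (p.2.1 == a1) then if sh p.2.2 then y else 0 else 0)
     + (if (p.1 == layer 2) && (p.2.1 == x2) then
          if (enum_rank p.2.2 < m)%N then
            if enum_rank p.2.2 == 0%N :> nat then - x else w (enum_rank p.2.2) - x
          else 0
        else 0))
  = \sum_(1 <= r < m) w r.
Proof.
move=> xm ym; rewrite !big_split /=.
rewrite (sum_section _ busy a1 (fun b => if sh b then y else 0)).
pose G (r : nat) : M := if (r < m)%N then if r == 0%N then - x else w r - x else 0.
rewrite (sum_section _ (fun=> layer 2) x2 (fun b => G (enum_rank b))).
rewrite -big_mkcond sumr_const /= (mulrn_dvd ym shm) addr0.
rewrite -(pair_bigA _ (fun s (y : U * U) => if s == 0 then 0 else x)) /=.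
rewrite big1 => [|s _]; last first.
  rewrite sumr_const card_prod; apply: (mulrn_dvd (l := m)); last by rewrite dvdn_mulr // m_dvd_U.
  by case: ifP; rewrite ?mul0rn.
rewrite add0r (reindex_onto enum_val (@enum_rank U)) => [|b _]; last by rewrite enum_rankK.
under eq_bigl do rewrite enum_valK eqxx.
under eq_bigr do rewrite enum_valK.
rewrite -(big_mkord predT G) (big_cat_nat (n := m)) //=; last first.
  by rewrite dvdn_leq ?m_dvd_U // cU expn_gt0.
rewrite [X in _ + X]big1_seq => [|r]; last first.
  by rewrite mem_index_iota /= => /andP [mr _]; rewrite /G ltnNge mr.
rewrite addr0 big_ltn // {1}/G /=.
rewrite big_nat (eq_bigr (fun r => w r - x)) => [|r /andP [r0 rm]]; last first.
  by rewrite /G rm gtn_eqF.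
rewrite -big_nat sumrB sumr_const_nat -[- x]mulr1n -mulNrn addrCA -mulrnDr.
by rewrite mulNrn add1n subn1 /= xm oppr0 addr0.
Qed.

Lemma busyE b : (layer 0 == busy b) = false /\ (layer 2 == busy b) = false.
Proof. by rewrite /busy; case: (ty b).1. Qed.

Lemma rank0 : exists b0 : U, enum_rank b0 = 0%N :> nat.
Proof.
have U0 : (0 < #|U|)%N by rewrite cU expn_gt0.
by exists (enum_val (Ordinal U0)); rewrite enum_valK.
Qed.

(** Apart from [E], all plane maps of the colour are translations. *)
Lemma translation_colour (o : option bool) (y : V) (h : 'Z_m -> U * U -> U * U) :
  let z : J := omap inl o in
  y *+ m = 0 ->
  (forall s v y, act ga (torus_part (even_step (s, (v, y)) z)) y = h s y) ->
  full (fun p : base => (p.1 + 1, h p.1 p.2)) ->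
  (forall s v a b, step m (plane_part (even_step (s, (v, (a, b))) z)) =
    if (s == layer 2) && in_context a b then step m (context v b o)
    else (if s == 0 then 0 else step m o)
       + (if (s == busy b) && (a == x1) then if sh b then y else 0 else 0)) ->
  full (move_all z).
Proof.
move=> z ym Hh Hfull Hv; have [b0 rb0] := rank0.
pose x := step m o; pose w r := step m (c r o).
have xm : x *+ m = 0.
  by rewrite /x; case: (o) => [[]|]; rewrite pairMnE /= ?mul0rn ?pchar_Zp.
apply: (plane_fibre Hh Hfull (k0 := (layer 2, (x2, b0))) (M := V)
  (C := fun g a => forall v, g v = v + a)
  (a := fun p => (if p.1 == 0 then 0 else x)
     + (if (p.1 == busy p.2.2) && (p.2.1 == x1) then if sh p.2.2 then y else 0 else 0)
     + (if (p.1 == layer 2) && (p.2.1 == x2) then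
          if (enum_rank p.2.2 < m)%N then
            if enum_rank p.2.2 == 0%N :> nat then - x else w (enum_rank p.2.2) - x
          else 0
        else 0))).
- by move=> g g' a e Hg v; rewrite -e.
- by move=> v; rewrite addr0.
- by move=> g g' a a' Hg Hg' v; rewrite /= Hg' Hg addrA.
- by rewrite /= (busyE b0).2 rb0 !eqxx /= addr0 subrr.
- move=> [s [a b]] nk v; rewrite /= Hv -/x; congr (_ + _); rewrite /in_context andbA.
  case: (boolP ((s == layer 2) && (a == x2))) => [/andP [/eqP s2 /eqP a2]|_] /=;
    last by rewrite addr0.
  rewrite s2 (busyE b).2 addr0 /=; case: ifP => [rm|]; last by rewrite addr0.
  rewrite /context; case: eqP => [r0|_]; last by rewrite addrC subrK.
  case/eqP: nk; rewrite s2 a2; congr (_, (_, _)); apply: enum_rank_inj.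
  by apply: val_inj; rewrite /= r0.
- move=> F; rewrite (context_sum x1 w xm ym) => HF.
  apply: full_eq (Efull o) => v; rewrite /= HF Hv eqxx /in_context eqxx rb0 /=.
  by rewrite /context rb0.
Qed.

Lemma full_extra : full (move_all None).
Proof.
pose aa (s : 'Z_m) : {ffun U -> nat} := [ffun b => (s == busy b : nat)].
pose h (s : 'Z_m) (y : U * U) : U * U :=
  if s == layer 2 then if y.1 == x1 then (y.1, ga ord0 y.2) else y
  else (iter (s == busy y.2) (ga (ty y.2).2) y.1, y.2).
apply: (translation_colour (o := None) (y := 0) (h := h)).
- by rewrite mul0rn.
- move=> [[|[|[|[|s]]]] sm] v [a b]; rewrite /even_step /h /busy /=.
  + by rewrite turn_in_None; case: (ty b).1.
  + by rewrite row_swap_None; case: (ty b).1.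
  + by rewrite mix_None; case: (a == x1) => //; case: ifP; rewrite ?torus_part_inl.
  + by rewrite row_swap_None; case: (ty b).1.
  + by case: (ty b).1.
- apply: (layers_sweep (ga := fun b => ga (ty b).2) (be := ga ord0) (a0 := x1)
    (k0 := layer 2) (aa := aa)) => // [|b|s /negbTE s2 y].
  + by apply/ffunP => b; rewrite !ffunE (busyE b).2.
  + rewrite sum_ffunE (eq_bigr (fun s => s == busy b : nat)) => [|s _]; last by rewrite ffunE.
    exact: sum_pred1.
  + by rewrite /h s2 ffunE.
- move=> [[|[|[|[|s]]]] sm] v a b; rewrite /even_step /=.
  + by rewrite turn_in_None !if_same addr0.
  + by rewrite row_swap_None !if_same addr0; case: ifP.
  + rewrite mix_None !if_same addr0; case: (eqVneq a x1) => [->|_]; first by rewrite in_context_x1.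
    by case: ifP; rewrite ?plane_part_inl.
  + by rewrite row_swap_None !if_same addr0; case: ifP.
  + by rewrite !if_same addr0.
Qed.

Definition turn_base (g : bool) (s : 'Z_m) (y : U * U) : U * U :=
  if s == 0 then if (phi y.1 + phi y.2 == 0) (+) g then (y.1, ga ord0 y.2) else (ga ord0 y.1, y.2)
  else y.

Lemma turn_base_full g : full (fun p : base => (p.1 + 1, turn_base g p.1 p.2)).
Proof.
apply: (skew_one (rho := fst) (chi := snd) (h := turn_base g) (k0 := 0) _ _ (full_succ (p := m))).
- by exists id => [[]|[]].
- by [].
- by move=> s /negbTE s0 y; rewrite /turn_base s0.
- rewrite /turn_base eqxx; case: g.
    apply: full_eq (diag_full_fst phiP phiS phiS (Hga ord0)) => y.
    by rewrite addbT; case: ifP.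
  apply: full_eq (diag_full_snd phiP phiS phiS (Hga ord0)) => y.
  by rewrite addbF.
Qed.

Lemma turn_base_gg g s v y :
  act ga (torus_part (even_step (s, (v, y)) (gg g))) y = turn_base g s y.
Proof.
case: s => [[|[|[|[|s]]]] sm]; case: y => a b; rewrite /even_step /turn_base /=.
- by rewrite turn_in_gg; case: ifP.
- by rewrite row_swap_gg; case: ifP.
- by rewrite mix_gg; case: ifP; rewrite ?torus_part_inl.
- by rewrite row_swap_gg; case: ifP.
- by [].
Qed.

Lemma full_gg0 : full (move_all (gg false)).
Proof.
apply: (translation_colour (o := Some false) (y := - step m (Some false))
  _ (turn_base_gg false) (turn_base_full false)).
  by rewrite mulNrn pairMnE /= mul0rn pchar_Zp // oppr0.
move=> s v a b; rewrite [omap _ _]/(gg false).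
case: s => [[|[|[|[|s]]]] sm]; rewrite /even_step /=.
- by rewrite turn_in_gg /busy; case: ifP; case: (ty b).1; rewrite /= addr0.
- rewrite row_swap_gg /busy; case: (ty b).1; rewrite /= ?addr0 //.
  by case: (a == x1); case: (sh b); rewrite /= ?addr0 ?subrr.
- rewrite mix_gg /busy; case: (ty b).1; case: ifP; rewrite /= ?plane_part_inl ?addr0 //.
- rewrite row_swap_gg /busy; case: (ty b).1; rewrite /= ?addr0 //.
  by case: (a == x1); case: (sh b); rewrite /= ?addr0 ?subrr.
- by rewrite /busy; case: (ty b).1; rewrite /= addr0.
Qed.

(** The exchanges with this colour take place on the line [v.1 == 0] only, so the
    plane maps are shears along the second coordinate. They commute since none of
    them moves the first coordinate, and the shears cancel in the total. *)
Lemma full_gg1 : full (move_all (gg true)).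
Proof.
have [b0 rb0] := rank0.
pose x : {ffun 'Z_m -> 'Z_m} := [ffun=> 1].
pose y : {ffun 'Z_m -> 'Z_m} := [ffun i => - (i == 0)%:R].
pose w r : {ffun 'Z_m -> 'Z_m} := [ffun=> (step m (c r (Some true))).2].
have fm (t : {ffun 'Z_m -> 'Z_m}) : t *+ m = 0.
  by apply/ffunP => i; rewrite ffunMnE ffunE -mulr_natr pchar_Zp // mulr0.
have stepc r : step m (c r (Some true)) = (0, (step m (c r (Some true))).2).
  by have := c_gg r; case: (c r (Some true)) => [[]|].
apply: (plane_fibre (turn_base_gg true) (turn_base_full true) (k0 := (layer 2, (x2, b0)))
  (M := {ffun 'Z_m -> 'Z_m}) (C := fun g t => forall v, g v = v + (0, t v.1))
  (a := fun p => (if p.1 == 0 then 0 else x)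
     + (if (p.1 == busy p.2.2) && (p.2.1 == x2) then if sh p.2.2 then y else 0 else 0)
     + (if (p.1 == layer 2) && (p.2.1 == x2) then
          if (enum_rank p.2.2 < m)%N then
            if enum_rank p.2.2 == 0%N :> nat then - x else w (enum_rank p.2.2) - x
          else 0
        else 0))).
- by move=> g g' a e Hg v; rewrite -e.
- by move=> v; rewrite ffunE; apply/esym/addr0.
- move=> g g' a a' Hg Hg' [i j]; rewrite /= Hg' Hg /= ffunE addr0 -addrA.
  by congr (_ + _); rewrite -[LHS]/(0 + 0, a i + a' i) addr0.
- by rewrite /= (busyE b0).2 rb0 !eqxx /= addr0 subrr.
- move=> [s [a b]] nk v; congr (_ + _).
  case: s nk => [[|[|[|[|s]]]] sm] nk; rewrite /even_step /=.
  + rewrite turn_in_gg /busy; case: ifP; case: (ty b).1; rewrite /= !addr0 ?ffunE //.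
  + rewrite row_swap_gg /busy; case: (ty b).1; rewrite /= !addr0 ?ffunE //.
    case: (a == x2); case: (sh b); rewrite /= ?ffunE ?addr0 //.
    by case: (v.1 == 0); rewrite /= ?subrr ?subr0.
  + rewrite mix_gg /busy (_ : (_ == _) = false) ?addr0 /=; last by case: (ty b).1.
    rewrite /in_context; have [a2|_] := eqVneq a x2; rewrite /= ?addr0 ?ffunE ?addr0 //;
      case: ifP => [rm|_];
      rewrite ?ffunE ?addr0 //.
    rewrite plane_part_inl /context; case: eqP => [r0|_]; last by rewrite !ffunE addrC subrK -stepc.
    case/eqP: nk; rewrite a2; apply: congr2; first exact: val_inj.
    by congr pair; apply: enum_rank_inj; apply: val_inj; rewrite /= r0.
  + rewrite row_swap_gg /busy; case: (ty b).1; rewrite /= !addr0 ?ffunE //.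
    case: (a == x2); case: (sh b); rewrite /= ?ffunE ?addr0 //.
    by case: (v.1 == 0); rewrite /= ?subrr ?subr0.
  + by rewrite /busy; case: (ty b).1; rewrite /= !addr0 ?ffunE.
- move=> F; rewrite (context_sum x2 w (fm x) (fm y)) => HF.
  apply: full_eq (Efull (Some true)) => v.
  rewrite /= HF /even_step /= mix_gg /in_context eqxx rb0 /= plane_part_inl /context rb0 /=.
  congr (_ + _); rewrite sum_ffunE.
  rewrite (eq_bigr (fun r => (0, (step m (c r (Some true))).2))) //.
  elim/big_rec2: _ => // r s t _ ->; rewrite ffunE.
  by rewrite -[LHS]/(0 + 0, (step m (c r (Some true))).2 + s) addr0.
Qed.

(** In the plane such a colour moves only at the columns [x1] and [x2] of the
    rows of type [(t, i)] that belong to [sh]. *)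
Lemma short_fibre t i z (h : 'Z_m -> U * U -> U * U) :
  i != ord0 ->
  (forall s v y, act ga (torus_part (even_step (s, (v, y)) z)) y = h s y) ->
  full (fun p : base => (p.1 + 1, h p.1 p.2)) ->
  (forall s v a b, plane_part (even_step (s, (v, (a, b))) z) =
    if (s == busy b) && (ty b == (t, i)) then plane_part (short_swap v a b None) else None) ->
  full (move_all z).
Proof.
move=> i0 Hh Hfull Hv.
pose q b : nat := sh b && (ty b == (t, i)).
have cq : coprime (\sum_b q b)%N m.
  rewrite sum_pred; have [c1 c2 _] := tyP i0.
  by case: (t) @q => _; rewrite ?c1 ?c2 ?coprime1n // coprimenS.
pose nn (p : base) : nat * nat :=
  (if (p.1 == busy p.2.2) && (p.2.1 == x1) then q p.2.2 else 0,
   if (p.1 == busy p.2.2) && (p.2.1 == x2) then q p.2.2 else 0)%N.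
have bijV : bijective (fun v : V => (v.1, v.2)) by exists id => [[]|[]].
apply: (@skew_tri V _ _ fst snd _ _ bijV (full_succ (p := m)) (full_succ (p := m)) _ _
  (fun p => (p.1, p.2.2)) (fun p => p.2.1) (move_all z) _
  (fun p v => v + step m (plane_part (even_step (p.1, (v, p.2)) z))) nn _ _ Hfull).
- by exists (fun q => (q.1.1, (q.2, q.1.2))) => [[s [v y]]|[[s y] v]].
- by move=> [s [v y]]; rewrite /move_all layered_plane_box /= Hh.
- have tri0 f : f =1 id -> tri fst snd (fun s : 'Z_m => s + 1) (fun s : 'Z_m => s + 1) f (0, 0)%N.
    by move=> Hf; exists (fun=> 0%N); [rewrite sum_nat_const muln0 | move=> v; rewrite Hf].
  move=> [s [a b]]; rewrite /nn /q /=; case: (eqVneq s (busy b)) => [sb|/negbTE sb] /=; last first.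
    by apply: tri0 => v; rewrite Hv sb /= addr0.
  rewrite sb; case: (boolP (ty b == (t, i))) => tb /=; last first.
    by rewrite andbF !if_same; apply: tri0 => v; rewrite Hv (negbTE tb) andbF /= addr0.
  rewrite andbT; case: (boolP (sh b)) => shb /=; last first.
    rewrite !if_same; apply: tri0 => v.
    by rewrite Hv tb eqxx /= short_swap_None (negbTE shb) addr0.
  have [a1|na1] := eqVneq a x1.
    rewrite a1 (negbTE x12); exists (fun=> 0%N); first by rewrite sum_nat_const muln0.
    move=> [v1 v2]; rewrite Hv tb eqxx /= short_swap_None shb eqxx.
    by rewrite /= addr0.
  have [a2|na2] := eqVneq a x2; last first.
    apply: tri0 => v.
    by rewrite Hv tb eqxx /= short_swap_None shb (negbTE na1) (negbTE na2) addr0.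
  exists (fun s => s == 0 : nat); first exact: sum_pred1.
  move=> [v1 v2]; rewrite Hv tb eqxx /= short_swap_None shb (negbTE na1) a2 eqxx /=.
  by case: (v1 == 0); rewrite /= ?addr0.
- by rewrite card_Zm // (sum_section _ busy x1 q).
- by rewrite card_Zm // (sum_section _ busy x2 q).
Qed.

Lemma cardC_dvd (P : pred U) : (m %| #|predC P| + #|P|)%N.
Proof. by rewrite addnC cardC m_dvd_U. Qed.

Lemma torus_part_short_swap v a b : torus_part (short_swap v a b None) = None.
Proof. by rewrite short_swap_None; case: (sh b) => //; case: (a == x1) => //; case: ifP. Qed.

Lemma full_ee i : i != ord0 -> full (move_all (ee i)).
Proof.
move=> i0; have [_ _ co] := tyP i0.
pose h (s : 'Z_m) (y : U * U) : U * U :=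
  match s : nat with
  | 1 => if ty y.2 == (false, i) then y else (ga i y.1, y.2)
  | 3 => (y.1, ga i y.2)
  | _ => (ga i y.1, y.2)
  end%N.
pose nn (s : 'Z_m) : nat * nat :=
  match s : nat with
  | 1 => (0, #|predC [pred b | ty b == (false, i)]|)
  | 3 => (1, 0)
  | _ => (0, #|U|)
  end%N.
apply: (short_fibre (t := false) (h := h) i0).
- move=> [[|[|[|[|s]]]] sm] v [a b]; rewrite /even_step /h /=.
  + by rewrite turn_in_ee.
  + by rewrite row_swap_ee; case: eqP => // _; rewrite torus_part_short_swap.
  + by rewrite mix_ee.
  + by rewrite (negbTE i0) row_swap_ff.
  + by [].
- apply: (layers_tri (pb := snd) (pa := fst) (be := ga i) (al := ga i) (n := nn)) => //.
  + by exists (fun y => (y.2, y.1)) => [[]|[]].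
  + move=> [[|[|[|[|s]]]] sm]; rewrite /nn /h /=;
      try by exists (fun=> 1%N); rewrite ?sum_nat_const ?muln1.
    * exists (fun b => (ty b != (false, i) : nat)); first by rewrite sum_pred.
      by move=> [a b] /=; case: eqP.
    * by exists (fun=> 0%N); rewrite ?sum_nat_const ?muln0.
  + by apply: coprime_U; rewrite !big_ord_recl /= sum_nat_const muln0 coprime1n.
  + apply: coprime_U; rewrite !big_ord_recl /= sum_nat_const card_ord.
    apply: (@coprime_dvdD _ #|[pred b | ty b == (false, i)]|); last exact: co.
    have := cardC_dvd [pred b | ty b == (false, i)].
    set x := #|predC _|; set y := #|[pred b | _]| => dv.
    rewrite [X in (_ %| X)%N](_ : _ = (x + y) + n.+2 * #|U|)%N; last by ring.
    by rewrite dvdn_add // dvdn_mull // m_dvd_U.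
- move=> [[|[|[|[|s]]]] sm] v a b; rewrite /even_step /=.
  + by rewrite turn_in_ee // /busy; case: (ty b).1.
  + rewrite row_swap_ee /busy; case: (ty b) => [[] j]; rewrite ?xpair_eqE //=.
    by case: eqP.
  + by rewrite mix_ee // /busy; case: (ty b).1.
  + rewrite (negbTE i0) row_swap_ff /busy; case: (ty b) => [[] j] //=.
  + by rewrite /busy; case: (ty b).1.
Qed.

Lemma full_ff i : i != ord0 -> full (move_all (ff i)).
Proof.
move=> i0; have [_ _ co] := tyP i0.
pose h (s : 'Z_m) (y : U * U) : U * U :=
  match s : nat with
  | 3 => if ty y.2 == (true, i) then y else (ga i y.1, y.2)
  | _ => (y.1, ga i y.2)
  end%N.
pose nn (s : 'Z_m) : nat * nat :=
  match s : nat with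
  | 3 => (0, #|predC [pred b | ty b == (true, i)]|)
  | _ => (1, 0)
  end%N.
apply: (short_fibre (t := true) (h := h) i0).
- move=> [[|[|[|[|s]]]] sm] v [a b]; rewrite /even_step /h /=.
  + by rewrite turn_in_ff.
  + by rewrite row_swap_ff.
  + by rewrite mix_ff.
  + rewrite (negbTE i0) row_swap_ee; case: eqP => // _.
    by rewrite torus_part_short_swap.
  + by [].
- apply: (layers_tri (pb := snd) (pa := fst) (be := ga i) (al := ga i) (n := nn)) => //.
  + by exists (fun y => (y.2, y.1)) => [[]|[]].
  + move=> [[|[|[|[|s]]]] sm]; rewrite /nn /h /=;
      try by exists (fun=> 0%N); rewrite ?sum_nat_const ?muln0.
    exists (fun b => (ty b != (true, i) : nat)); first by rewrite sum_pred.
    by move=> [a b] /=; case: eqP.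
  + apply: coprime_U; rewrite !big_ord_recl /= sum_nat_const card_ord muln1 !add1n.
    by rewrite add0n coprimenS.
  + apply: coprime_U; rewrite !big_ord_recl /= sum_nat_const muln0 !add0n addn0.
    by apply: coprime_dvdD (cardC_dvd _) _; apply: co.
- move=> [[|[|[|[|s]]]] sm] v a b; rewrite /even_step /=.
  + by rewrite turn_in_ff // /busy; case: (ty b).1.
  + rewrite row_swap_ff /busy; case: (ty b) => [[] j] //=.
  + by rewrite mix_ff // /busy; case: (ty b).1.
  + rewrite (negbTE i0) row_swap_ee /busy; case: (ty b) => [[] j]; rewrite ?xpair_eqE //=.
    by case: eqP.
  + by rewrite /busy; case: (ty b).1.
Qed.

(** Only the layer [0] moves these colours in the plane, and there the two
    directions of the plane are separated by an antidiagonal. *)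
Lemma torus_fibre g z (nn : 'Z_m * V -> nat * nat) :
  (forall s v y, plane_part (even_step (s, (v, y)) z) =
     if s == 0 then Some ((v.1 + v.2 == 0) (+) g) else None) ->
  (forall p, tri fst snd (ga ord0) (ga ord0)
     (fun y => act ga (torus_part (even_step (p.1, (p.2, y)) z)) y) (nn p)) ->
  coprime (\sum_p (nn p).1)%N m -> coprime (\sum_p (nn p).2)%N m -> full (move_all z).
Proof.
move=> Hp Ht c1 c2.
have bijY : bijective (fun y : U * U => (y.1, y.2)) by exists id => [[]|[]].
pose r (p : 'Z_m * V) : 'Z_m * V :=
  (p.1 + 1, if p.1 == 0 then p.2 + step m (Some ((p.2.1 + p.2.2 == 0) (+) g)) else p.2).
have Hr : full r.
  apply: (skew_one (rho := fst) (chi := snd) (r := fun s : 'Z_m => s + 1) (k0 := 0)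
    (h := fun s (v : V) => if s == 0 then v + step m (Some ((v.1 + v.2 == 0) (+) g)) else v)).
  - by exists id => [[]|[]].
  - by [].
  - exact: full_succ.
  - by move=> s /negbTE -> v.
  rewrite eqxx; have idb : bijective (@id 'Z_m) by exists id.
  case: g {Hp r} => /=.
    apply: full_eq (diag_full_fst (phi := id) (psi := id) idb (fun _ => erefl) (fun _ => erefl)
      (full_succ (p := m))) => [[v1 v2]] /=.
    by case: ifP => _; apply: congr2; rewrite /= ?addr0.
  apply: full_eq (diag_full_snd (phi := id) (psi := id) idb (fun _ => erefl) (fun _ => erefl)
    (full_succ (p := m))) => [[v1 v2]] /=.
  by case: ifP => _; apply: congr2; rewrite /= ?addr0.
apply: (@skew_tri _ _ _ fst snd _ _ bijY (Hga ord0) (Hga ord0) _ _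
  (fun p => (p.1, p.2.1)) (fun p => p.2.2) (move_all z) _ _ nn _ _ Hr Ht
  (coprime_U c1) (coprime_U c2)).
- by exists (fun q => (q.1.1, (q.1.2, q.2))) => [[s [v y]]|[[s v] y]].
- move=> [s [v y]]; rewrite /move_all layered_plane_box /= Hp /r /=.
  by case: ifP => _ //; rewrite addr0.
Qed.

Lemma dvd_sum_layer (G : 'Z_m -> nat) : (m %| \sum_(p : 'Z_m * V) G p.1)%N.
Proof.
rewrite -(pair_bigA _ (fun s (v : V) => G s)) /=; apply: dvdn_sum => s _.
by rewrite sum_nat_const card_prod card_Zm // -mulnA dvdn_mulr.
Qed.

Lemma predU_gt0 : #|U|.-1.+1 = #|U|.
Proof. by rewrite prednK // cU expn_gt0. Qed.

Lemma full_ee0 : full (move_all (ee ord0)).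
Proof.
pose all0 := [forall b, ty b == (false, ord0)].
have row1 v a b : row_swap false v a b (ee ord0) = if all0 then None else ee ord0.
  rewrite row_swap_ee short_swap_None; case: ty0 => H.
    have -> : all0 by apply/forallP.
    by rewrite H; case: (boolP (sh b)) => // /sh0; rewrite (eqP (H b)).
  have -> : all0 = false.
    by apply/negbTE/negP => /forallP /(_ b) /eqP tb; have := H b; rewrite tb.
  by case: eqP => // tb; have := H b; rewrite tb.
have row3 v a b : row_swap true v a b (ee ord0) = ee ord0.
  by rewrite row_swap_ee (negbTE (tyt0 b)).
pose G (s : 'Z_m) : nat := match s : nat with 0 => 0 | 1 => ~~ all0 | _ => 1 end%N.
pose p2 : 'Z_m * V := (layer 2, 0).
apply: (torus_fibre (g := false)
  (nn := fun p => if p == p2 then (0, #|U|.-1)%N else (G p.1, 0%N))).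
- move=> [[|[|[|[|s]]]] sm] v [a b]; rewrite /even_step /=.
  + by rewrite turn_in_ee0 addbF.
  + by rewrite row1; case: (all0).
  + by rewrite mix_ee0; case: (v == 0); case: (a == x1).
  + by rewrite row3.
  + by [].
- move=> [s v].
  have cst (s' : 'Z_m) j f : (forall y, f y = (iter j (ga ord0) y.1, y.2)) -> G s' = j ->
      tri fst snd (ga ord0) (ga ord0) f (G s', 0%N).
    by move=> Hf ->; exists (fun=> 0%N); [rewrite sum_nat_const muln0 | move=> y; rewrite Hf].
  case: eqP => [[-> ->]|ne].
    exists (fun a => a != x1 : nat); first exact: sum_predC1.
    by move=> [a b]; rewrite /even_step /= mix_ee0 eqxx; case: eqP.
  case: s ne => [[|[|[|[|s]]]] sm] ne /=; rewrite /even_step /=.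
  + by apply: (cst _ 0%N) => // [[a b]]; rewrite turn_in_ee0.
  + by apply: (cst _ (~~ all0)) => // [[a b]]; rewrite row1; case: (all0).
  + apply: (cst _ 1%N) => // [[a b]]; rewrite mix_ee0; case: eqP => // v0.
    by case: ne; rewrite v0; congr (_, _); apply: val_inj.
  + by apply: (cst _ 1%N) => // [[a b]]; rewrite row3.
  + by apply: (cst _ 1%N) => // [[a b]].
- apply: (@coprime_dvdD _ 1); last exact: coprime1n.
  rewrite -(sum_pred1 p2) -big_split /=.
  rewrite (eq_bigr (fun p => G p.1)) => [|p _]; first exact: dvd_sum_layer.
  by case: eqP => [->|_]; rewrite ?addn0.
- rewrite (eq_bigr (fun p => if p == p2 then #|U|.-1 else 0%N)) => [|p _]; last by case: ifP.
  rewrite -big_mkcond big_pred1_eq.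
  by apply: (@coprime_dvdD _ 1); rewrite ?coprime1n // addn1 predU_gt0 m_dvd_U.
Qed.

Lemma full_ff0 : full (move_all (ff ord0)).
Proof.
pose G (s : 'Z_m) : nat := match s : nat with 0 => 0 | 2 => #|U|.-1 | _ => #|U| end%N.
pose p2 : 'Z_m * V := (layer 2, 0).
apply: (torus_fibre (g := true)
  (nn := fun p => if p == p2 then (1, 0)%N else (0%N, G p.1))).
- move=> [[|[|[|[|s]]]] sm] v [a b]; rewrite /even_step /=.
  + by rewrite turn_in_ff0 addbT.
  + by rewrite row_swap_ff.
  + by rewrite mix_ff0; case: (v == 0); case: (a == x1).
  + by rewrite row_swap_ff.
  + by [].
- move=> [s v]; case: eqP => [[-> ->]|ne].
    exists (fun=> 0%N); first by rewrite sum_nat_const muln0.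
    by move=> [a b]; rewrite /even_step /= mix_ff0 eqxx.
  have cst f : (forall y, f y = (y.1, ga ord0 y.2)) ->
      tri fst snd (ga ord0) (ga ord0) f (0%N, #|U|).
    by move=> Hf; exists (fun=> 1%N); [rewrite sum_nat_const muln1 | move=> y; rewrite Hf].
  case: s ne => [[|[|[|[|s]]]] sm] ne /=; rewrite /even_step /=.
  + exists (fun=> 0%N); first by rewrite sum_nat_const muln0.
    by move=> [a b]; rewrite turn_in_ff0.
  + by apply: cst => [[a b]]; rewrite row_swap_ff.
  + exists (fun a => a != x1 : nat); first exact: sum_predC1.
    move=> [a b]; rewrite mix_ff0; case: eqP => [v0|_]; last by case: eqP.
    by case: ne; rewrite v0; congr (_, _); apply: val_inj.
  + by apply: cst => [[a b]]; rewrite row_swap_ff.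
  + by apply: cst => [[a b]].
- rewrite (eq_bigr (fun p => p == p2 : nat)) => [|p _]; last by case: ifP.
  by rewrite sum_pred1 coprime1n.
- pose P := [pred p : 'Z_m * V | (p.1 == layer 2) && (p.2 != 0)].
  apply: (@coprime_dvdD _ #|P|).
    rewrite -sum_pred -big_split /=; apply: dvdn_sum => [[s v]] _.
    rewrite /P /= /p2 xpair_eqE.
    case: s => [[|[|[|[|s]]]] sm]; rewrite /G /= ?dvdn0 ?addn0 ?m_dvd_U //.
    by case: (v == 0); rewrite /= ?addn0 ?dvdn0 ?addn1 ?predU_gt0 ?m_dvd_U.
  rewrite (@eq_card _ P (predX (pred1 (layer 2)) (predC1 0))) => [|[s v]]; last by rewrite !inE.
  rewrite cardX card1 mul1n cardC1 card_prod card_Zm //.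
  by apply: (@coprime_dvdD _ 1); rewrite ?coprime1n // addn1 prednK // dvdn_mull.
Qed.
End EvenStep.

Lemma decomposes_even_step (m k : nat) : (4 <= m)%N -> odd_plane m ->
  decomposes m 'I_k.+1 -> decomposes m (option (bool + ('I_k.+1 + 'I_k.+1))).
Proof.
case: m => [|[|[|[|n]]]] // m4 [E [c [Einj cinj c_gg Efull]]].
move=> [U [de [ga [tor rec Hga]]]].
have cU : #|U| = (n.+4 ^ k.+1)%N by rewrite (@toroidal_card n.+4 _ _ _ _ tor) ?card_ord.
have dvU : (n.+4 %| #|U|)%N by rewrite cU dvdn_exp.
have leU : (k * n.+4 <= #|U|)%N.
  by rewrite cU expnSr leq_mul2r /= ltnW // ltn_expl.
have U1 : (1 < #|U|)%N by apply: leq_trans (dvdn_leq _ dvU); rewrite // cU expn_gt0.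
have [phi phiP phiS] := full_index U1 (Hga ord0).
have /card_gt1P [x1 [x2 [_ _ x12]]] := U1.
have [ty [sh [ty0 sh0 shm tyt0 tyP]]] := even_labels (isT : 1 < n.+4)%N leU dvU.
exists ('Z_n.+4 * (('Z_n.+4 * 'Z_n.+4) * (U * U)))%type,
  (layered (box (@plane n.+4) (box de de))), (move_all ga E c ty sh phi x1 x2); split.
- apply/toroidal_layered/toroidal_box; first exact: toroidal_plane.
  exact: toroidal_box.
- apply: recoloring_trans
    (recoloring_layered _ (recoloring_box (recoloring_refl _) (recoloring_box rec rec))) _.
  by exists (even_step E c ty sh phi x1 x2) => // p; apply: even_step_inj.
- move=> [[[]|[i|i]]|].
  + exact: full_gg1.
  + exact: full_gg0.
  + by have [->|i0] := eqVneq i ord0; [apply: full_ee0 | apply: full_ee].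
  + by have [->|i0] := eqVneq i ord0; [apply: full_ff0 | apply: full_ff].
  + exact: full_extra.
Qed.

(** * Hamilton decompositions of directed tori *)

(** Even dimensions are halved; an odd dimension [d] is reached from
    [(d - 1) / 2] or from [(d - 3) / 2] according to the parity of [m]. *)
Theorem decomposes_ord (m d : nat) : (3 <= m)%N -> (0 < d)%N -> decomposes m 'I_d.
Proof.
move=> m3; have m1 : (1 < m)%N by exact: ltnW.
have transfer (I : finType) e : #|I| = e -> decomposes m I -> decomposes m 'I_e.
  by move=> cI; apply: decomposes_card; rewrite card_ord.
have three : decomposes m (option bool).
  case: (boolP (odd m)) => odm; first exact: decomposes3_odd.
  apply: decomposes3_of_odd_plane => //.
  have [m6|m6] := leqP 6 m; first exact: odd_plane_ge6.
  by rewrite (_ : m = 4)%N; [exact: odd_plane_4 | lia].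
elim/ltn_ind: d => d IH d0.
have [d1|d1] := eqVneq d 1%N.
  by apply: transfer (decomposes_unit m); rewrite card_unit d1.
have [d3|d3] := eqVneq d 3%N.
  by apply: transfer three; rewrite card_option card_bool d3.
have half_gt0 : (0 < d./2 < d)%N by lia.
case: (boolP (odd d)) => odd_d; last first.
  apply: transfer (decomposes_double m1 (IH d./2 _ _)); try lia.
  by rewrite card_sum card_ord; lia.
case: (boolP (odd m)) => odm.
  have := IH d./2; case E : d./2 => [|[|k]]; try lia.
  move=> /(_ ltac:(lia) isT) /(decomposes_odd_step m3 odm).
  by apply: transfer; rewrite card_option card_sum card_ord; lia.
have := IH d./2.-1; case E : d./2.-1 => [|k]; first lia.
have m4 : (4 <= m)%N by lia.
have pl : odd_plane m.
  have [m6|m6] := leqP 6 m; first exact: odd_plane_ge6.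
  by rewrite (_ : m = 4)%N; [exact: odd_plane_4 | lia].
move=> /(_ ltac:(lia) isT) /(decomposes_even_step m4 pl).
by apply: transfer; rewrite card_option !card_sum card_bool !card_ord; lia.
Qed.

(** * Cayley digraphs of bases *)

Lemma full_hamilton (V : finZmodType) (S : {mset V}) (ch : V -> occ S) :
  full (fun x => x + tag (ch x)) ->
  @hamilton_cycle (Cay S) [set a : V * occ S | ch a.1 == a.2].
Proof.
set g := (fun x => _) => Hg; have gi := full_inj Hg.
pose p : seq (V * occ S) := [seq (x, ch x) | x <- orbit g 0].
have all_orbit v : v \in orbit g 0.
  by rewrite -fconnect_orbit; have [j <-] := Hg 0 v; rewrite fconnect_iter.
have ps : map (@source (Cay S)) p = orbit g 0 by rewrite -map_comp map_id.
exists p; split.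
- by rewrite cycle_map; apply: sub_cycle (cycle_orbit gi 0) => x y.
- by rewrite ps orbit_uniq.
- by move=> v; rewrite ps all_orbit.
- apply/setP => [[x o]]; rewrite !inE /=; apply/eqP/mapP => [<-|[y _ [-> ->]] //].
  by exists x.
Qed.

(** Linear combinations of the basis carry the torus to the module, and its unit
    translations to the translations by the basis vectors. *)
Lemma basis_choices (m d : nat) (I : finType) (A : {set I}) (b : I -> 'rV['Z_m]_d) :
  (3 <= m)%N -> (0 < d)%N -> module_basis A b ->
  #|A| = d /\ exists ch : 'I_d -> 'rV['Z_m]_d -> I,
    [/\ forall i x, ch i x \in A, forall x, injective (ch^~ x)
      & forall i, full (fun x => x + b (ch i x))].
Proof.
move=> m3 d0 [free span]; have m1 : (1 < m)%N by exact: ltnW.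
pose bb (j : 'I_#|A|) := b (enum_val j).
pose L (F : {ffun 'I_#|A| -> 'Z_m}) : 'rV['Z_m]_d := \sum_j F j *: bb j.
have LE (c : I -> 'Z_m) : \sum_(i in A) c i *: b i = L [ffun j => c (enum_val j)].
  by rewrite big_enum_val; apply: eq_bigr => j _; rewrite ffunE.
have Linj : injective L.
  move=> F G /eqP; rewrite -subr_eq0 -sumrB => /eqP FG.
  have [A0|/card_gt0P [i0 i0A]] := posnP #|A|.
    by apply/ffunP => j; have := ltn_ord j; rewrite {2}A0.
  apply/ffunP => j; pose c i := (F - G) (enum_rank_in i0A i).
  apply/eqP; rewrite -subr_eq0; apply/eqP.
  have := free c _ (enum_val j) (enum_valP j); rewrite /c enum_valK_in !ffunE; apply.
  rewrite LE -[RHS]FG; apply: eq_bigr => i _.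
  by rewrite !ffunE enum_valK_in scalerBl.
have Lsurj v : exists F, L F = v.
  by have [c ->] := span v; rewrite LE; eexists.
have cardL : #|{ffun 'I_#|A| -> 'Z_m}| = #|{: 'rV['Z_m]_d}|.
  apply/eqP; rewrite eqn_leq (leq_card _ Linj) /= -(card_codom Linj).
  by apply/subset_leq_card/subsetP => v _; have [F <-] := Lsurj v; apply: codom_f.
have cA : #|A| = d.
  move: cardL; rewrite card_ffun card_mx card_Zm // card_ord mul1n => /eqP.
  by rewrite eqn_exp2l // => /eqP.
split=> //.
have [L' LK L'K] := inj_card_bij Linj (eq_leq (esym cardL)).
have [T [de [ga [[Phi [Psi PK KP] HPhi] [ka ki Hk] Hfull]]]] :=
  decomposes_ord m3 (etrans (congr1 _ cA) d0 : (0 < #|A|)%N).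
pose ch i x := enum_val (ka (Psi (L' x)) (cast_ord (esym cA) i)).
exists ch; split.
- by move=> i x; apply: enum_valP.
- by move=> x i j /enum_val_inj/ki/cast_ord_inj.
- move=> i; apply: (full_map (h := L \o Phi) _ _ (Hfull (cast_ord (esym cA) i))) => [v|t] /=.
    by exists (Psi (L' v)); rewrite /= KP L'K.
  rewrite /ch LK PK Hk HPhi /L; set j := ka _ _.
  rewrite [in RHS](_ : b _ = bb j) //.
  under eq_bigr do rewrite !ffunE scalerDl.
  rewrite big_split /=; congr (_ + _); rewrite (bigD1 j) //= eqxx scale1r big1 ?addr0 //.
  by move=> l /negbTE ->; rewrite scale0r.
Qed.

Lemma cayley_decomposable (m d k : nat) (S : {mset 'rV['Z_m]_d}) :
  (3 <= m)%N -> (0 < d)%N -> (0 < k)%N ->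
  (exists P : {set {set occ S}},
     [/\ partition P [set: occ S], #|P| = k
       & forall B, B \in P ->
           module_basis B (fun o : occ S => tag o : 'rV['Z_m]_d)]) ->
  hamilton_decomposable (Cay S) (k * d).
Proof.
move=> m3 d0 k0 [P [/and3P [/eqP covP triP _] cP basP]].
have /card_gt0P [B0 B0P] : (0 < #|P|)%N by rewrite cP.
have choices B : exists ch : 'I_d -> 'rV['Z_m]_d -> occ S, B \in P ->
    [/\ forall i x, ch i x \in B, forall x, injective (ch^~ x)
      & forall i, full (fun x => x + tag (ch i x))].
  case: (boolP (B \in P)) => BP.
    by have [_ [ch H]] := basis_choices m3 d0 (basP B BP); exists ch.
  by have [_ [ch _]] := basis_choices m3 d0 (basP B0 B0P); exists ch.
have [ch Hch] := fin_all_exists choices.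
pose C (q : {set occ S} * 'I_d) : {set Defs.arc (Cay S)} :=
  [set a : 'rV['Z_m]_d * occ S | ch q.1 q.2 a.1 == a.2].
have Cinj q q' a : q.1 \in P -> q'.1 \in P -> a \in C q -> a \in C q' -> q = q'.
  case: q q' a => [B i] [B' i'] [x o] /= BP BP'; rewrite !inE /= => /eqP e /eqP e'.
  have [inB _ _] := Hch B BP; have [inB' _ _] := Hch B' BP'.
  have BB : B = B'.
    apply/eqP; apply: contraTT isT => /(trivIsetP triP _ _ BP BP') /pred0P /(_ o) /=.
    by rewrite -{1}e inB -e' inB'.
  by rewrite -BB in e' *; have [_ inj _] := Hch B BP; congr pair; apply: (inj x); rewrite e e'.
have Cmem q : C q != set0.
  by apply/set0Pn; exists (0, ch q.1 q.2 0); rewrite inE.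
exists [set C q | q in setX P [set: 'I_d]]; split.
- apply/and3P; split.
  + apply/eqP/setP => [[x o]]; rewrite [RHS]inE; apply/bigcupP.
    have : o \in cover P by rewrite covP inE.
    move=> /bigcupP [B BP oB]; have [inB inj _] := Hch B BP.
    have [cB _] := basis_choices m3 d0 (basP B BP).
    have : o \in [set ch B i x | i : 'I_d].
      suff -> : [set ch B i x | i : 'I_d] = B by [].
      apply/eqP; rewrite eqEcard card_imset //.
      by rewrite card_ord cB leqnn andbT; apply/subsetP => _ /imsetP [i _ ->].
    move=> /imsetP [i _ ->]; exists (C (B, i)); last by rewrite inE.
    by apply/imsetP; exists (B, i) => //; rewrite !inE BP.
  + apply/trivIsetP => _ _ /imsetP [q + ->] /imsetP [q' + ->].
    rewrite !inE !andbT => qP q'P ne; apply/pred0P => a /=; apply/negP => /andP [aq aq'].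
    by rewrite (Cinj q q' a) // eqxx in ne.
  + by apply/imsetP => [[q _ /esym/eqP]]; rewrite (negbTE (Cmem q)).
- rewrite card_in_imset ?cardsX ?cP ?cardsT ?card_ord // => q q'; rewrite !inE !andbT => qP q'P e.
  by have /set0Pn [a aq] := Cmem q; apply: (Cinj q q' a) => //; rewrite -e.
- move=> _ /imsetP [q + ->]; rewrite !inE andbT => qP.
  by have [_ _ Hfull] := Hch q.1 qP; apply: full_hamilton.
Qed.

(** The basis of a multiset without repetitions can be indexed by its
    occurrences. *)
Lemma module_basis_imset (R : nzRingType) (W : lmodType R) (I J : finType) (A : {set I})
    (h : I -> J) (b : J -> W) :
  {in A &, injective h} -> module_basis (h @: A) b -> module_basis A (b \o h).
Proof.
move=> hi [free span]; split=> [c c0 i iA|v]; last first.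
  by have [c ->] := span v; exists (c \o h); rewrite big_imset.
pose c' j := if [pick i in A | h i == j] is Some i then c i else 0.
have c'E l : l \in A -> c' (h l) = c l.
  move=> lA; rewrite /c'; case: pickP => [i' /andP [i'A /eqP e]|/(_ l)].
    by rewrite (hi _ _ i'A lA e).
  by rewrite lA eqxx.
rewrite -c'E //; apply: free; last exact: imset_f.
by rewrite big_imset // -[RHS]c0; apply: eq_bigr => l lA; rewrite c'E.
Qed.

Theorem corollary10p6 (m d : nat) (hm : (3 <= m)%N) (hd : (2 <= d)%N) :
  (forall (k : nat) (S : {mset 'rV['Z_m]_d}),
     (1 <= k)%N ->
     (exists P : {set {set occ S}},
        [/\ partition P [set: occ S], #|P| = k
          & forall B, B \in P ->
              module_basis B (fun o : occ S => tag o : 'rV['Z_m]_d)]) ->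
     hamilton_decomposable (Cay S) (k * d)) /\
  (forall B : {set 'rV['Z_m]_d},
     module_basis B (fun x : 'rV['Z_m]_d => x) ->
     hamilton_decomposable (Cay (mset_of_set B)) d).
Proof.
have d0 : (0 < d)%N by exact: ltnW.
split=> [k S k0 HP|B HB]; first exact: cayley_decomposable.
rewrite -[d in hamilton_decomposable _ d]mul1n; apply: cayley_decomposable => //.
set S := mset_of_set B.
have SE x : S x = (x \in B) :> nat.
  by rewrite /S /mset_of_set mset_seqE count_uniq_mem ?enum_uniq // mem_enum.
have occ0 x (i : 'I_(S x)) : i = 0%N :> nat.
  by apply/eqP; rewrite -leqn0 -ltnS (leq_trans (ltn_ord i)) // SE; case: (x \in B).
have tag_inj : injective (fun o : occ S => tag o).
  move=> [x i] [y j] /= xy; rewrite -xy in j *; congr Tagged; apply: val_inj.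
  by rewrite /= !occ0.
have tagB : [set tag o | o in [set: occ S]] = B.
  apply/setP => x; apply/imsetP/idP => [[[y i] _ ->] /=|xB].
    by have := ltn_ord i; rewrite {2}SE; case: (y \in B).
  have Sx : (0 < S x)%N by rewrite SE xB.
  by exists (Tagged (fun y => 'I_(S y)) (Ordinal Sx)).
have bas : module_basis [set: occ S] (fun o : occ S => tag o : 'rV['Z_m]_d).
  apply: (@module_basis_imset _ _ _ _ _ (fun o : occ S => tag o) id); last by rewrite tagB.
  by move=> o o' _ _; apply: tag_inj.
exists [set [set: occ S]]; split; last by move=> A /set1P ->.
- apply/and3P; split; first by rewrite /cover big_set1.
    by apply/trivIsetP => A A' /set1P -> /set1P ->; rewrite eqxx.
  rewrite !inE eq_sym -card_gt0; have [-> _] := basis_choices hm d0 bas.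
  exact: d0.
- by rewrite cards1.
Qed.
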